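(* Let $(\mathcal{A},\varphi)$ be a $W^*$-probability space. Let $\alpha>0$, let $\sigma,\theta>0$ with $\sigma+\theta>1$, and put $\lambda=\sigma+\theta$. Let $\mathbb{V}$ and $\mathbb{U}$ in $\mathcal{A}$ be freely independent (self-adjoint) random variables such that $\mathbb{V}$ is free-Poisson with parameters $(\lambda,\alpha)$ and $\mathbb{U}$ is free-binomial with parameters $(\sigma,\theta)$. Define $$\mathbb{X}=\mathbb{V}^{1/2}\,\mathbb{U}\,\mathbb{V}^{1/2},\qquad \mathbb{Y}=\mathbb{V}-\mathbb{V}^{1/2}\,\mathbb{U}\,\mathbb{V}^{1/2}.$$ Then $\mathbb{X}$ and $\mathbb{Y}$ are freely independent, and their distributions are free-Poisson with parameters $(\sigma,\alpha)$ and $(\theta,\alpha)$, respectively.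
   Context: A $W^*$-probability space $(\mathcal{A},\varphi)$ is a von Neumann algebra $\mathcal{A}\subset\mathcal{B}(H)$ with a faithful, normal, tracial state $\varphi$ ($\varphi(\mathbb{X}\mathbb{Y})=\varphi(\mathbb{Y}\mathbb{X})$). The distribution of a self-adjoint $\mathbb{X}\in\mathcal{A}$ is the probability measure $\mu$ on $\mathbb{R}$ with $\varphi(\mathbb{X}^r)=\int t^r\,\mu(dt)$ for all $r\ge 1$. Free independence is in Voiculescu's sense: $\mathbb{X},\mathbb{Y}$ are free if the unital subalgebras they generate are free, i.e. $\varphi$ vanishes on every product of elements with $\varphi$-value $0$ in which neighbouring factors come from different subalgebras. Free-Poisson distribution $\nu(\lambda,\alpha)$, with rate $\lambda\ge 0$ and jump size $\alpha>0$: $\nu(\lambda,\alpha)=\max\{0,1-\lambda\}\,\delta_0+\tilde\nu$, where $\tilde\nu$ is supported on $(\alpha(1-\sqrt\lambda)^2,\alpha(1+\sqrt\lambda)^2)$ with density $\tilde\nu(dx)=\frac{1}{2\pi\alpha x}\sqrt{4\lambda\alpha^2-(x-\alpha(1+\lambda))^2}\,dx$ (equivalently, its $n$-th free cumulant is $\lambda\alpha^n$ for all $n\ge1$). Free-binomial distribution $\beta(\sigma,\theta)$, for $\sigma,\theta>0$, $\sigma+\theta>1$: $\beta(\sigma,\theta)=(1-\sigma)\mathbf{1}_{\{0<\sigma<1\}}\delta_0+\tilde\beta+(1-\theta)\mathbf{1}_{\{0<\theta<1\}}\delta_1$, where $\tilde\beta$ is supported on $(x_-,x_+)$, $x_{\pm}=\left(\sqrt{\frac{\sigma}{\sigma+\theta}\left(1-\frac{1}{\sigma+\theta}\right)}\pm\sqrt{\frac{1}{\sigma+\theta}\left(1-\frac{\sigma}{\sigma+\theta}\right)}\right)^2$,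 with density $\tilde\beta(dx)=(\sigma+\theta)\frac{\sqrt{(x-x_-)(x_+-x)}}{2\pi x(1-x)}\,dx$. *)

(* Defs.v *)
From HB Require Import structures.
From mathcomp Require Import all_boot all_order all_algebra sesquilinear complex.
From mathcomp Require Import all_classical all_reals all_analysis.
From mathcomp Require Import measurable_realfun ring lra.

Set Implicit Arguments.
Unset Strict Implicit.
Unset Printing Implicit Defensive.

Import Order.TTheory GRing.Theory Num.Theory.
Import numFieldNormedType.Exports.

Local Open Scope classical_set_scope.
Local Open Scope ring_scope.
Local Open Scope complex_scope.

(* The form is linear in the first argument, and it induces the norm for which
   the space is complete. *)
Structure hilbertSpace (R : realType) := HilbertSpace {
  hilbert_sort :> completeNormedModType R[i];
  inner : {dot hilbert_sort for Num.conj};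
  inner_normE : forall x : hilbert_sort, `|x| ^+ 2 = inner x x
}.
Arguments inner {R} h.

Record bounded_op (R : realType) (H : hilbertSpace R) := BoundedOp {
  op_fun :> H -> H;
  op_linear : linear op_fun;
  op_continuous : continuous op_fun
}.

Notation "''B' ( H )" := (bounded_op H) (at level 8, format "''B' ( H )").

Section BoundedOperators.
Variables (R : realType) (H : hilbertSpace R).
Implicit Types (S T : 'B(H)) (a : R[i]).

HB.instance Definition _ T :=
  GRing.isLinear.Build R[i] H H *:%R (op_fun T) (op_linear T).

Lemma bounded_opP S T : op_fun S =1 op_fun T -> S = T.
Proof.
case: S T => [f lf cf] [g lg cg] /= /funext fg.
by subst g; congr BoundedOp; exact: Prop_irrelevance.
Qed.

HB.instance Definition _ := gen_eqMixin 'B(H).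
HB.instance Definition _ := gen_choiceMixin 'B(H).

Let zero_linear : linear (fun _ : H => 0 : H).
Proof. by move=> a x y; rewrite scaler0 addr0. Qed.

Let one_linear : linear (fun x : H => x).
Proof. by []. Qed.

Let opp_linear T : linear (fun x : H => - T x).
Proof. by move=> a x y; rewrite linearP opprD scalerN. Qed.

Let add_linear S T : linear (fun x : H => S x + T x).
Proof. by move=> a x y; rewrite !linearP scalerDr addrACA. Qed.

Let scale_linear a T : linear (fun x : H => a *: T x).
Proof. by move=> b x y; rewrite linearP scalerDr !scalerA mulrC. Qed.

Let mul_linear S T : linear (fun x : H => S (T x)).
Proof. by move=> a x y; rewrite !linearP. Qed.

Let zero_continuous : continuous (fun _ : H => 0 : H).
Proof. by move=> x; exact: cvg_cst. Qed.

Let one_continuous : continuous (fun x : H => x).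
Proof. by move=> x; exact: cvg_id. Qed.

Let opp_continuous T : continuous (fun x : H => - T x).
Proof. by move=> x; apply: cvgN; exact: op_continuous. Qed.

Let add_continuous S T : continuous (fun x : H => S x + T x).
Proof. by move=> x; apply: cvgD; exact: op_continuous. Qed.

Let scale_continuous a T : continuous (fun x : H => a *: T x).
Proof. by move=> x; apply: cvgZr; exact: op_continuous. Qed.

Let mul_continuous S T : continuous (fun x : H => S (T x)).
Proof.
by move=> x; apply: (@continuous_comp _ _ _ T S); exact: op_continuous.
Qed.

Definition op_zero : 'B(H) := BoundedOp zero_linear zero_continuous.
Definition op_one : 'B(H) := BoundedOp one_linear one_continuous.
Definition op_opp T : 'B(H) := BoundedOp (opp_linear T) (@opp_continuous T).
Definition op_add S T : 'B(H) :=
  BoundedOp (add_linear S T) (@add_continuous S T).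
Definition op_scale a T : 'B(H) :=
  BoundedOp (scale_linear a T) (@scale_continuous a T).
Definition op_mul S T : 'B(H) :=
  BoundedOp (mul_linear S T) (@mul_continuous S T).

Fact op_addA : associative op_add.
Proof. by move=> S T U; apply: bounded_opP => x /=; rewrite addrA. Qed.
Fact op_addC : commutative op_add.
Proof. by move=> S T; apply: bounded_opP => x /=; rewrite addrC. Qed.
Fact op_add0 : left_id op_zero op_add.
Proof. by move=> T; apply: bounded_opP => x /=; rewrite add0r. Qed.
Fact op_addN : left_inverse op_zero op_opp op_add.
Proof. by move=> T; apply: bounded_opP => x /=; rewrite addNr. Qed.

HB.instance Definition _ :=
  GRing.isZmodule.Build 'B(H) op_addA op_addC op_add0 op_addN.

Fact op_mulA : associative op_mul.
Proof. by move=> S T U; apply: bounded_opP. Qed.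
Fact op_1mul : left_id op_one op_mul.
Proof. by move=> T; apply: bounded_opP. Qed.
Fact op_mul1 : right_id op_one op_mul.
Proof. by move=> T; apply: bounded_opP. Qed.
Fact op_mulDl : left_distributive op_mul +%R.
Proof. by move=> S T U; apply: bounded_opP. Qed.
Fact op_mulDr : right_distributive op_mul +%R.
Proof. by move=> S T U; apply: bounded_opP => x /=; rewrite linearD. Qed.

(* Only a pzRingType: 1 = 0 in B(H) when H = 0, hence no lalgType instance. *)
HB.instance Definition _ := GRing.Zmodule_isPzRing.Build 'B(H)
  op_mulA op_1mul op_mul1 op_mulDl op_mulDr.

Fact op_scaleA a b T : op_scale a (op_scale b T) = op_scale (a * b) T.
Proof. by apply: bounded_opP => x /=; rewrite scalerA. Qed.
Fact op_scale1 : left_id 1 op_scale.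
Proof. by move=> T; apply: bounded_opP => x /=; rewrite scale1r. Qed.
Fact op_scaleDr : right_distributive op_scale +%R.
Proof. by move=> a S T; apply: bounded_opP => x /=; rewrite scalerDr. Qed.
Fact op_scaleDl T : {morph op_scale^~ T : a b / a + b}.
Proof. by move=> a b; apply: bounded_opP => x /=; rewrite scalerDl. Qed.

HB.instance Definition _ := GRing.Zmodule_isLmodule.Build R[i] 'B(H)
  op_scaleA op_scale1 op_scaleDr op_scaleDl.

Lemma op0E (x : H) : (0 : 'B(H)) x = 0. Proof. by []. Qed.
Lemma op1E (x : H) : (1 : 'B(H)) x = x. Proof. by []. Qed.
Lemma opNE T x : (- T) x = - T x. Proof. by []. Qed.
Lemma opDE S T x : (S + T) x = S x + T x. Proof. by []. Qed.
Lemma opZE a T x : (a *: T) x = a *: T x. Proof. by []. Qed.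
Lemma opME S T x : (S * T) x = S (T x). Proof. by []. Qed.

Lemma op_scalerAl a S T : a *: (S * T) = (a *: S) * T.
Proof. by apply: bounded_opP. Qed.

Lemma op_scalerAr a S T : a *: (S * T) = S * (a *: T).
Proof. by apply: bounded_opP => x; rewrite !(opZE, opME) linearZ. Qed.

End BoundedOperators.

Section VonNeumannAlgebras.
Variables (R : realType) (H : hilbertSpace R).
Implicit Types (S T : 'B(H)) (A B D : set 'B(H)) (phi : 'B(H) -> R[i]).

Definition is_adjoint S T := forall x y, inner H (S x) y = inner H x (T y).

Definition self_adjoint T := is_adjoint T T.

(* In R[i], 0 <= z means that z is real and nonnegative. *)
Definition positive_op T := forall x, 0 <= inner H (T x) x.

Definition op_le S T := positive_op (T - S).

Definition commutant A : set 'B(H) := [set T | forall S, A S -> S * T = T * S].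

(* Every bounded operator has an adjoint in B(H), so the first condition says that
   A is closed under adjoints; the second one is von Neumann's A = A''. *)
Definition von_neumann_algebra A :=
  (forall S T, A S -> is_adjoint S T -> A T) /\ commutant (commutant A) = A.

Definition self_adjoint_part A : set 'B(H) := A `&` [set T | self_adjoint T].

Definition directed D := D !=set0 /\
  forall S T, D S -> D T -> exists2 U, D U & op_le S U /\ op_le T U.

Definition op_sup A D T := [/\ self_adjoint_part A T,
  forall S, D S -> op_le S T &
  forall U, self_adjoint_part A U -> (forall S, D S -> op_le S U) -> op_le T U].

Definition state_on A phi :=
  [/\ forall (a : R[i]) S T, A S -> A T ->
        phi (a *: S + T) = a * phi S + phi T,
      forall T, A T -> positive_op T -> 0 <= phi T &
      phi 1 = 1].

Definition faithful_on A phi :=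
  forall T, A T -> positive_op T -> phi T = 0 -> T = 0.

Definition tracial_on A phi :=
  forall S T, A S -> A T -> phi (S * T) = phi (T * S).

(* phi (sup D) is the least upper bound of phi @` D; that it is an upper bound
   is the positivity of phi. *)
Definition normal_on A phi := forall D T,
  D `<=` self_adjoint_part A -> directed D -> op_sup A D T ->
  forall c : R[i], (forall S, D S -> phi S <= c) -> phi T <= c.

End VonNeumannAlgebras.

(* wstate is only meaningful on the algebra walg; its values elsewhere are
   unconstrained. *)
Structure wstarProbSpace (R : realType) := WstarProbSpace {
  whilbert : hilbertSpace R;
  walg : set 'B(whilbert);
  wstate : 'B(whilbert) -> R[i];
  walg_von_neumann : von_neumann_algebra walg;
  wstate_state : state_on walg wstate;
  wstate_faithful : faithful_on walg wstate;
  wstate_normal : normal_on walg wstate;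
  wstate_tracial : tracial_on walg wstate
}.
Arguments walg {R} w _.
Arguments wstate {R} w _.

Section FreeProbability.
Variables (R : realType) (W : wstarProbSpace R).
Local Notation H := (whilbert W).
Implicit Types (S T X Y : 'B(H)) (B C : set 'B(H)).

(* A positive V in a von Neumann algebra has exactly one positive square root in
   it, so quantifying over the S with is_sqrt_of S V amounts to naming V^(1/2). *)
Definition is_sqrt_of S V := [/\ walg W S, positive_op S & S * S = V].

Definition unital_subalgebra B :=
  [/\ B 1,
      forall (a : R[i]) S T, B S -> B T -> B (a *: S + T) &
      forall S T, B S -> B T -> B (S * T)].

Definition generated_subalgebra X : set 'B(H) :=
  smallest unital_subalgebra [set X].

(* The word s records, with each factor, the subalgebra it is taken from:
   B for true and C for false. *)
Definition free_subalgebras B C := forall s : seq (bool * 'B(H)),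
  (0 < size s)%N -> sorted (fun p q => p.1 != q.1) s ->
  (forall p, p \in s -> (if p.1 then B else C) p.2 /\ wstate W p.2 = 0) ->
  wstate W (\prod_(p <- s) p.2) = 0.

Definition freely_independent X Y :=
  free_subalgebras (generated_subalgebra X) (generated_subalgebra Y).

Definition has_distribution X
    (mu : {measure set (measurableTypeR R) -> \bar R}) :=
  [/\ walg W X, self_adjoint X, mu setT = 1%E &
      forall r, (0 < r)%N ->
        mu.-integrable setT (fun t => (t ^+ r)%:E) /\
        wstate W (X ^+ r) = (\int[mu]_t t ^+ r)%:C].

End FreeProbability.

Section Density.
Variables (R : realType) (f : R -> R).
Hypothesis mf : measurable_fun [set: measurableTypeR R] f.
Local Notation mu := (@lebesgue_measure R).

(* The positive part makes this a measure for every measurable f; it changes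
   nothing for the densities used below, which are nonnegative for admissible
   parameters (free_poisson_pdf_ge0, free_binomial_pdf_ge0). *)
Definition density_measure
    of measurable_fun [set: measurableTypeR R] f :=
  fun A : set (measurableTypeR R) => (\int[mu]_(x in A) (f^\+ x)%:E)%E.

Let density0 : density_measure mf set0 = 0%E.
Proof. by rewrite /density_measure integral_set0. Qed.

Let density_ge0 A : (0 <= density_measure mf A)%E.
Proof. by apply: integral_ge0 => x _; rewrite lee_fin funrpos_ge0. Qed.

Let density_sigma_additive : semi_sigma_additive (density_measure mf).
Proof.
move=> A mA tA mUA; rewrite /density_measure ge0_integral_bigcup//.
- apply: is_cvg_ereal_nneg_natsum_cond => n _ _.
  by apply: integral_ge0 => x _; rewrite lee_fin funrpos_ge0.
- apply/measurable_EFinP; apply: measurable_funrpos.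
  exact: measurable_funS mf.
- by move=> x _; rewrite lee_fin funrpos_ge0.
Qed.

HB.instance Definition _ := isMeasure.Build _ _ _ (density_measure mf)
  density0 density_ge0 density_sigma_additive.

End Density.

Section FreeDistributions.
Variable R : realType.
Implicit Types s t l a x y : R.

Lemma measurable_mem_itv x y :
  measurable_fun [set: measurableTypeR R] (fun z : R => z \in `]x, y[).
Proof. by apply: (measurable_fun_bool true); rewrite setTI preimage_true. Qed.

Lemma measurable_inv : measurable_fun [set: R] (@GRing.inv R).
Proof.
rewrite -(setUv [set (0 : R)]); apply/measurable_funU => //.
  exact: measurableC.
split; first exact: measurable_fun_set1.
apply: open_continuous_measurable_fun.
  by rewrite openC; exact: closed_eq.
by move=> x; rewrite inE => /eqP x0; exact: inv_continuous.
Qed.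

Lemma measurable_sqrt : measurable_fun [set: R] (@Num.sqrt R).
Proof. by apply: continuous_measurable_fun; exact: sqrt_continuous. Qed.

Definition free_poisson_pdf l a : R -> R :=
  fun x =>
    if x \in `]a * (1 - Num.sqrt l) ^+ 2, a * (1 + Num.sqrt l) ^+ 2[ then
      1 / (2 * pi * a * x) *
        Num.sqrt (4 * l * a ^+ 2 - (x - a * (1 + l)) ^+ 2)
    else 0.

Lemma measurable_free_poisson_pdf l a :
  measurable_fun [set: measurableTypeR R] (free_poisson_pdf l a).
Proof.
apply: measurable_fun_ifT => //; first exact: measurable_mem_itv.
apply: measurable_funM.
  apply: measurable_funM => //.
  by apply: (measurableT_comp measurable_inv); exact: measurable_funM.
apply: (measurableT_comp measurable_sqrt); apply: measurable_funB => //.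
by apply: measurable_funX; exact: measurable_funB.
Qed.

Lemma free_poisson_pdf_ge0 l a x : 0 < a -> 0 <= free_poisson_pdf l a x.
Proof.
move=> a0; rewrite /free_poisson_pdf; case: ifPn => // /itvP lux.
have x0 : 0 <= x by rewrite (@le_trans _ _ (a * (1 - Num.sqrt l) ^+ 2)) ?lux//
     mulr_ge0 ?sqr_ge0// ltW.
by rewrite mulr_ge0 ?sqrtr_ge0// divr_ge0// !mulr_ge0 ?pi_ge0// ltW.
Qed.

Definition free_binomial_lower s t : R :=
  (Num.sqrt (s / (s + t) * (1 - 1 / (s + t)))
     - Num.sqrt (1 / (s + t) * (1 - s / (s + t)))) ^+ 2.

Definition free_binomial_upper s t : R :=
  (Num.sqrt (s / (s + t) * (1 - 1 / (s + t)))
     + Num.sqrt (1 / (s + t) * (1 - s / (s + t)))) ^+ 2.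

Definition free_binomial_pdf s t : R -> R :=
  fun x =>
    if x \in `]free_binomial_lower s t, free_binomial_upper s t[ then
      (s + t) *
        (Num.sqrt ((x - free_binomial_lower s t) * (free_binomial_upper s t - x))
          / (2 * pi * x * (1 - x)))
    else 0.

Lemma measurable_free_binomial_pdf s t :
  measurable_fun [set: measurableTypeR R] (free_binomial_pdf s t).
Proof.
apply: measurable_fun_ifT => //; first exact: measurable_mem_itv.
apply: measurable_funM => //; apply: measurable_funM.
  apply: (measurableT_comp measurable_sqrt).
  by apply: measurable_funM; exact: measurable_funB.
apply: (measurableT_comp measurable_inv); apply: measurable_funM.
  exact: measurable_funM.
exact: measurable_funB.
Qed.

Lemma free_binomial_upper_le1 s t : 0 < s -> 0 < t -> 1 < s + t ->
  free_binomial_upper s t <= 1.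
Proof.
move=> s0 t0 st1; have st0 : 0 < s + t by rewrite addr_gt0.
rewrite /free_binomial_upper.
set p := s / (s + t); set q := 1 / (s + t).
have p0 : 0 <= p by rewrite divr_ge0// ltW.
have q0 : 0 <= q by rewrite divr_ge0// ltW.
have p1 : 0 <= 1 - p by rewrite subr_ge0 ler_pdivrMr// mul1r lerDl ltW.
have q1 : 0 <= 1 - q by rewrite subr_ge0 ler_pdivrMr// mul1r ltW.
rewrite (sqrtrM _ p0) (sqrtrM _ q0).
have := sqr_sqrtr p0; have := sqr_sqrtr q0.
have := sqr_sqrtr p1; have := sqr_sqrtr q1.
move: (Num.sqrt p) (Num.sqrt q) (Num.sqrt (1 - p)) (Num.sqrt (1 - q)).
move=> u w v z z2 v2 w2 u2.
have -> : 1 = (u ^+ 2 + v ^+ 2) * (w ^+ 2 + z ^+ 2).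
  by rewrite u2 v2 w2 z2; ring.
rewrite -subr_ge0 (_ : _ - _ = (u * w - v * z) ^+ 2) ?sqr_ge0//; ring.
Qed.

Lemma free_binomial_pdf_ge0 s t x : 0 < s -> 0 < t -> 1 < s + t ->
  0 <= free_binomial_pdf s t x.
Proof.
move=> s0 t0 st1; rewrite /free_binomial_pdf; case: ifPn => //.
rewrite in_itv/= => /andP[lx xu].
have x0 : 0 <= x by rewrite (le_trans _ (ltW lx))// sqr_ge0.
have x1 : 0 <= 1 - x.
  by rewrite subr_ge0 (le_trans (ltW xu))// free_binomial_upper_le1.
rewrite mulr_ge0 ?addr_ge0 ?(ltW s0) ?(ltW t0)// divr_ge0 ?sqrtr_ge0//.
by rewrite !mulr_ge0 ?pi_ge0.
Qed.

Fact max0_ge0 x : 0 <= Num.max 0 x. Proof. by rewrite le_max lexx. Qed.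

Definition max0 x : {nonneg R} := NngNum (max0_ge0 x).

Definition free_poisson l a : {measure set (measurableTypeR R) -> \bar R} :=
  measure_add (mscale (max0 (1 - l)) \d_(0 : measurableTypeR R))
              (density_measure (measurable_free_poisson_pdf l a)).

Lemma free_poissonE l a (A : set (measurableTypeR R)) :
  free_poisson l a A = ((Num.max 0 (1 - l))%:E * dirac (0%R : measurableTypeR R) A +
    density_measure (measurable_free_poisson_pdf l a) A)%E.
Proof. exact: measure_addE. Qed.

(* For s > 0, max 0 (1 - s) is 1 - s if 0 < s < 1, and 0 otherwise. *)
Definition free_binomial s t : {measure set (measurableTypeR R) -> \bar R} :=
  measure_add
    (measure_add (mscale (max0 (1 - s)) \d_(0 : measurableTypeR R))
                 (density_measure (measurable_free_binomial_pdf s t)))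
    (mscale (max0 (1 - t)) \d_(1 : measurableTypeR R)).

Lemma free_binomialE s t (A : set (measurableTypeR R)) :
  free_binomial s t A = ((Num.max 0 (1 - s))%:E * dirac (0%R : measurableTypeR R) A +
    density_measure (measurable_free_binomial_pdf s t) A +
    (Num.max 0 (1 - t))%:E * dirac (1%R : measurableTypeR R) A)%E.
Proof.
by apply: etrans; [exact: measure_addE | congr (_ + _)%E; exact: measure_addE].
Qed.

End FreeDistributions.

(* Main.v *)
Require Import Defs.
From HB Require Import structures.
From mathcomp Require Import all_boot all_order all_algebra sesquilinear complex.
From mathcomp Require Import all_classical all_reals all_analysis.
From mathcomp Require Import measurable_realfun ring lra.

(** Write phi for the state. For a variable Z of a pair generating an algebra of
    noncommutative polynomials, consider the Schwinger-Dyson relation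
      phi(p(Z) Q) = sum over Q = A Z B of phi(A q1(Z)) phi(q2(Z) B)
    for all words Q. When Q is restricted to powers of Z, it is a quadratic
    recursion between moments. Free independence extends it from powers of Z to
    all words. For the free-Poisson law of rate l and jump a it reads
      phi(Z Q) = a l phi(Q) + a sum phi(A) phi(Z B),
    and for the free-binomial law, with l = sigma + theta,
      phi((l Z - sigma) Q) = sum phi(A (1 - Z)) phi(Z B).
    By traciality the moments of (X, Y) are those of words in U V and (1 - U) V.
    The relation for V followed by the relation for U on the term of lower degree
    gives exactly the free-Poisson relations of rate sigma and theta for X and Y.
    Conversely, these relations imply by induction that alternating centered
    words have trace zero, and they determine the marginal moments.

    The densities enter through their moment recursions. Up to a factor x or
    x (1 - x) they are semicircular, and Chebyshev polynomials give the quadratic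
    recursion of the semicircle law. The remaining integral of the semicircle
    density divided by x is computed with a Poisson kernel. *)

Set Implicit Arguments.
Unset Strict Implicit.
Unset Printing Implicit Defensive.

Import Order.TTheory GRing.Theory Num.Theory.
Import numFieldNormedType.Exports.

Local Open Scope classical_set_scope.
Local Open Scope ring_scope.

(** * Functionals on words in two variables *)

Section LinearExtension.
Variables (F : comNzRingType) (V : lmodType F).
Implicit Types (f g : {poly F}) (c : nat -> V).

Definition poly_extension c f : V := \sum_(i < size f) f`_i *: c i.

Lemma poly_extension_widen c f n : (size f <= n)%N ->
  poly_extension c f = \sum_(i < n) f`_i *: c i.
Proof.
move=> fn; rewrite /poly_extension -!(big_mkord xpredT (fun i => f`_i *: c i)).
rewrite [RHS](@big_cat_nat _ _ _ (size f))//=.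
rewrite [X in _ + X]big_nat_cond [X in _ + X]big1 ?addr0// => i.
by rewrite andbT => /andP[si _]; rewrite nth_default// scale0r.
Qed.

Lemma poly_extensionP c a f g :
  poly_extension c (a *: f + g) = a *: poly_extension c f + poly_extension c g.
Proof.
pose n := maxn (size f) (size g).
have fn : (size f <= n)%N by rewrite leq_maxl.
have gn : (size g <= n)%N by rewrite leq_maxr.
have fgn : (size (a *: f + g)%R <= n)%N.
  apply: leq_trans (size_polyD _ _) _; rewrite geq_max gn andbT.
  exact: leq_trans (size_scale_leq _ _) fn.
rewrite (poly_extension_widen c fn) (poly_extension_widen c gn).
rewrite (poly_extension_widen c fgn) scaler_sumr -big_split/=.
by apply: eq_bigr => i _; rewrite coefD coefZ scalerDl scalerA.
Qed.

Lemma poly_extensionXn c n : poly_extension c 'X^n = c n.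
Proof.
rewrite /poly_extension size_polyXn big_ord_recr/= coefXn eqxx scale1r.
rewrite big1 ?add0r// => i _; rewrite coefXn lt_eqF ?scale0r//.
exact: ltn_ord.
Qed.

Lemma poly_linear_extV (L M : {poly F} -> V) :
  (forall a f g, L (a *: f + g) = a *: L f + L g) ->
  (forall a f g, M (a *: f + g) = a *: M f + M g) ->
  (forall n, L 'X^n = M 'X^n) -> L =1 M.
Proof.
move=> linL linM LM f.
have zero (N : {poly F} -> V) :
    (forall a f g, N (a *: f + g) = a *: N f + N g) -> N 0 = 0.
  by move=> lN; have := lN (-1) 0 0; rewrite scaler0 addr0 scaleN1r addNr.
rewrite -[f]coefK poly_def.
elim/big_ind: _ => [|x y Lx Ly|i _]; first by rewrite !zero.
  by rewrite -[x]scale1r linL linM Lx Ly.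
by rewrite -[_ *: _]addr0 linL linM !zero ?LM.
Qed.

End LinearExtension.

Lemma poly_linear_ext (F : comNzRingType) (L M : {poly F} -> F) :
  (forall a f g, L (a *: f + g) = a * L f + L g) ->
  (forall a f g, M (a *: f + g) = a * M f + M g) ->
  (forall n, L 'X^n = M 'X^n) -> L =1 M.
Proof. exact: (@poly_linear_extV F F^o). Qed.

(** * Words of polynomials in two noncommuting variables *)

Section PolyWords.
Variable F : comNzRingType.
Local Notation word := (seq (bool * {poly F})).
Implicit Types (a s t w A B : word) (f g p q : {poly F}) (b : bool) (N tau : word -> F).

(* A word lists polynomials in two noncommuting variables, indexed by bool. The
   three conditions say that N factors through the product of the word in the
   free algebra. *)
Record slot_linear N : Prop := SlotLinear {
  slot_lin : forall a s b c f g,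
    N (a ++ (b, c *: f + g) :: s) =
    c * N (a ++ (b, f) :: s) + N (a ++ (b, g) :: s);
  slot_mul : forall a s b f g,
    N (a ++ [:: (b, f), (b, g) & s]) = N (a ++ (b, f * g) :: s);
  slot_one : forall a s b, N (a ++ (b, 1) :: s) = N (a ++ s)
}.

Lemma slot_linear0 : slot_linear (fun _ => 0).
Proof. by split=> *; rewrite ?mulr0 ?addr0. Qed.

Lemma slot_linearD N1 N2 : slot_linear N1 -> slot_linear N2 ->
  slot_linear (fun s => N1 s + N2 s).
Proof.
move=> [l1 m1 o1] [l2 m2 o2]; split=> *.
- by rewrite l1 l2; ring.
- by rewrite m1 m2.
- by rewrite o1 o2.
Qed.

Lemma slot_linearB N1 N2 : slot_linear N1 -> slot_linear N2 ->
  slot_linear (fun s => N1 s - N2 s).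
Proof.
move=> [l1 m1 o1] [l2 m2 o2]; split=> *.
- by rewrite l1 l2; ring.
- by rewrite m1 m2.
- by rewrite o1 o2.
Qed.

Lemma slot_linearZ x N : slot_linear N -> slot_linear (fun s => x * N s).
Proof.
move=> [l1 m1 o1]; split=> *.
- by rewrite l1; ring.
- by rewrite m1.
- by rewrite o1.
Qed.

Lemma slot_linearM N x : slot_linear N -> slot_linear (fun s => N s * x).
Proof.
move=> [l1 m1 o1]; split=> *.
- by rewrite l1; ring.
- by rewrite m1.
- by rewrite o1.
Qed.

Lemma slot_linear_sum (I : Type) (r : seq I) (N : I -> word -> F) :
  (forall i, slot_linear (N i)) -> slot_linear (fun s => \sum_(i <- r) N i s).
Proof.
move=> lN; elim: r => [|i r [l1 m1 o1]].
  split=> *; rewrite !big_nil// mulr0 addr0//.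
case: (lN i) => l2 m2 o2.
split=> *; rewrite !big_cons.
- by rewrite l1 l2; ring.
- by rewrite m1 m2.
- by rewrite o1 o2.
Qed.

Lemma slot_linear_catl A N : slot_linear N -> slot_linear (fun s => N (A ++ s)).
Proof. by move=> [l m o]; split=> *; rewrite !catA (l, m, o). Qed.

Lemma slot_linear_catr B N : slot_linear N -> slot_linear (fun s => N (s ++ B)).
Proof.
by move=> [l m o]; split=> *; rewrite -!catA !cat_cons (l, m, o).
Qed.

Lemma slot_const N : slot_linear N -> forall a s b c,
  N (a ++ (b, c%:P) :: s) = c * N (a ++ s).
Proof.
move=> lN a s b c; have [l _ o] := lN.
have z : N (a ++ (b, 0) :: s) = 0.
  by have := l a s b (-1) 0 0; rewrite scaler0 addr0 mulN1r addNr.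
by rewrite -alg_polyC -[_%:A]addr0 l o z addr0.
Qed.

Lemma slot_lin_cons N (lN : slot_linear N) s b c f g :
  N ((b, c *: f + g) :: s) = c * N ((b, f) :: s) + N ((b, g) :: s).
Proof. exact: (slot_lin lN [::]). Qed.

Lemma slot_mul_cons N (lN : slot_linear N) s b f g :
  N [:: (b, f), (b, g) & s] = N ((b, f * g) :: s).
Proof. exact: (slot_mul lN [::]). Qed.

Lemma slot_one_cons N (lN : slot_linear N) s b : N ((b, 1) :: s) = N s.
Proof. exact: (slot_one lN [::]). Qed.

Lemma slot_const_cons N (lN : slot_linear N) s b c :
  N ((b, c%:P) :: s) = c * N s.
Proof. exact: (slot_const lN [::]). Qed.

Lemma slot_linB_cons N (lN : slot_linear N) s b f g :
  N ((b, f - g) :: s) = N ((b, f) :: s) - N ((b, g) :: s).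
Proof. by rewrite -scaleN1r addrC slot_lin_cons// mulN1r addrC. Qed.

Definition alternating s := sorted (fun b c : bool => b != c) (unzip1 s).

Lemma alternating_catl s t : alternating (s ++ t) -> alternating s.
Proof. by rewrite /alternating /unzip1 map_cat => /cat_sorted2[]. Qed.

Lemma alternating_catr s t : alternating (s ++ t) -> alternating t.
Proof. by rewrite /alternating /unzip1 map_cat => /cat_sorted2[]. Qed.

Lemma alternating_rcons2 s x y :
  alternating (rcons (rcons s x) y) = alternating (rcons s x) && (x.1 != y.1).
Proof.
rewrite /alternating /unzip1 !map_rcons; case: [seq i.1 | i <- s] => [|z u] /=.
  by rewrite andbT.
by rewrite !rcons_path last_rcons.
Qed.


(** The letters of [s] move one at a time into an alternating centered prefix [a]. Each splits into
    a centered part and a constant, and the constant shortens the word. A letter with the index of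
    the last letter of [a] is first multiplied with it, and the product is centered instead. *)
Lemma slot_linear_alternating N (e : bool -> {poly F} -> F) : slot_linear N ->
  (forall s, alternating s ->
    (forall x, x \in s -> exists f, x = (x.1, f - (e x.1 f)%:P)) -> N s = 0) ->
  forall s, N s = 0.
Proof.
move=> lN N0 s; have [l m o] := lN.
pose cent (x : bool * {poly F}) := exists f, x = (x.1, f - (e x.1 f)%:P).
suff H n : forall s a, (size s <= n)%N -> alternating a ->
    (forall x, x \in a -> cent x) -> N (a ++ s) = 0 by apply: (H (size s) s [::]).
elim: n => [|n IH] {}s a.
  by rewrite leqn0 size_eq0 => /eqP -> alta ca; rewrite cats0; exact: N0.
case: s => [_ alta ca|[b f] s]; first by rewrite cats0; exact: N0.
rewrite ltnS => sn alta ca.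
have split_c a' g : N (a' ++ (b, g) :: s) =
    N (rcons a' (b, g - (e b g)%:P) ++ s) + e b g * N (a' ++ s).
  have := l a' s b 1 (g - (e b g)%:P) (e b g)%:P.
  by rewrite scale1r subrK mul1r (slot_const lN) cat_rcons.
case/lastP: a alta ca => [|a [b' g]] alta ca.
  rewrite split_c (IH s [::]) // mulr0 addr0 IH //= => x.
  by rewrite inE => /eqP ->; exists f.
have alta' : alternating a by move: alta; rewrite -cats1 => /alternating_catl.
have ca' x : x \in a -> cent x by move=> xa; apply: ca; rewrite mem_rcons inE xa orbT.
have [bb'|bb'] := eqVneq b' b.
  rewrite cat_rcons bb' m split_c (IH s a)// mulr0 addr0; apply: IH => //.
    by move: alta; rewrite bb' /alternating /unzip1 !map_rcons.
  move=> x; rewrite mem_rcons inE => /predU1P[->|/ca'//].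
  by exists (g * f).
rewrite split_c (IH s (rcons a (b', g)))// mulr0 addr0; apply: IH => //.
  by rewrite alternating_rcons2 alta.
move=> x; rewrite mem_rcons inE => /predU1P[->|/ca//].
by exists f.
Qed.

(** Horner's scheme in each slot: the constant term drops the letter, and a factor ['X] moves left
    into the prefix [u]. *)
Lemma slot_linear_letters N : slot_linear N ->
  (forall u : seq bool, N [seq (b, 'X) | b <- u] = 0) -> forall s, N s = 0.
Proof.
move=> lN N0 s; have [l m o] := lN.
suff H : forall s u, N ([seq (b, 'X) | b <- u] ++ s) = 0 by exact: (H s [::]).
elim=> {s} [|[b f] s IH] u; first by rewrite cats0.
elim/poly_ind: f u => [|f c IHf] u.
  by rewrite -[0 : {poly F}]/(0%:P) (slot_const lN) mul0r.
rewrite -[_ * 'X]scale1r l mul1r (slot_const lN) IH mulr0 addr0 mulrC -m.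
by have := IHf (rcons u b); rewrite map_rcons cat_rcons.
Qed.

End PolyWords.

(** * Schwinger-Dyson relations *)

Section DifferenceQuotient.
Variable F : comNzRingType.
Local Notation word := (seq (bool * {poly F})).
Implicit Types (a s t w A B : word) (f g p q : {poly F}) (b : bool).
Variable tau : word -> F.
Hypothesis ltau : slot_linear tau.
Variables (d : bool) (q1 q2 : {poly F}).

(* With phi the state and D Voiculescu's free difference quotient, this is
   (phi (x) phi)((A q1 (x) 1) (D f) (1 (x) q2 B)). *)
Definition diff_quotient A f B :=
  \sum_(i < size f) f`_i * \sum_(k < i)
    (tau (A ++ [:: (d, 'X^k * q1)]) * tau ((d, q2 * 'X^(i - k.+1)) :: B)).

(** [A] holds the letters already read; each remaining letter of index [d] is differentiated in
    turn. With [A] empty this is the right-hand side of the Schwinger-Dyson relation. *)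
Fixpoint cyclic_diff A s := match s with
  | [::] => 0
  | (b, f) :: s' => (if b == d then diff_quotient A f s' else 0) +
      cyclic_diff (A ++ [:: (b, f)]) s'
  end.

Let dqE A f B : diff_quotient A f B = @poly_extension F F^o (fun i => \sum_(k < i)
  (tau (A ++ [:: (d, 'X^k * q1)]) * tau ((d, q2 * 'X^(i - k.+1)) :: B))) f.
Proof. by []. Qed.

Lemma diff_quotientP A B c f g :
  diff_quotient A (c *: f + g) B = c * diff_quotient A f B + diff_quotient A g B.
Proof. by rewrite !dqE poly_extensionP. Qed.

Lemma diff_quotientXn A B n : diff_quotient A 'X^n B = \sum_(k < n)
  (tau (A ++ [:: (d, 'X^k * q1)]) * tau ((d, q2 * 'X^(n - k.+1)) :: B)).
Proof. by rewrite dqE poly_extensionXn. Qed.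

Lemma diff_quotientX A B : diff_quotient A 'X B =
  tau (A ++ [:: (d, q1)]) * tau ((d, q2) :: B).
Proof.
by rewrite -['X]/('X^1) diff_quotientXn big_ord1 expr0 mul1r mulr1.
Qed.

Lemma diff_quotientC A B c : diff_quotient A c%:P B = 0.
Proof.
have d1 : diff_quotient A 1 B = 0.
  by rewrite -(expr0 'X) diff_quotientXn big_ord0.
have := diff_quotientP A B c 1 0; rewrite addr0 alg_polyC d1 mulr0 add0r => ->.
by rewrite dqE /poly_extension size_poly0 big_ord0.
Qed.

Lemma slot_linear_diff_quotientl f B : slot_linear (fun A => diff_quotient A f B).
Proof.
apply: slot_linear_sum => i; apply: slot_linearZ; apply: slot_linear_sum => k.
by apply: slot_linearM; exact: slot_linear_catr.
Qed.

Lemma slot_linear_diff_quotientr A f : slot_linear (fun B => diff_quotient A f B).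
Proof.
apply: slot_linear_sum => i; apply: slot_linearZ; apply: slot_linear_sum => k.
apply: slot_linearZ.
exact: (slot_linear_catl [:: (d, q2 * 'X^(i - k.+1))] ltau).
Qed.

Lemma tau_poly_linear A b h1 h2 B c f g :
  tau (A ++ (b, h1 * (c *: f + g) * h2) :: B) =
  c * tau (A ++ (b, h1 * f * h2) :: B) + tau (A ++ (b, h1 * g * h2) :: B).
Proof.
by rewrite mulrDr mulrDl -scalerAr -scalerAl (slot_lin ltau).
Qed.

Lemma diff_quotientMX A f B : diff_quotient A (f * 'X) B =
  diff_quotient A f ((d, 'X) :: B) + tau (A ++ [:: (d, f * q1)]) * tau ((d, q2) :: B).
Proof.
move: f; apply: poly_linear_ext => [c f g|c f g|n].
- by rewrite mulrDl -scalerAl diff_quotientP.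
- have := tau_poly_linear A d 1 q1 [::] c f g; rewrite !mul1r => ->.
  by rewrite diff_quotientP; ring.
- rewrite -exprSr !diff_quotientXn big_ord_recr/= subnn expr0 mulr1; congr (_ + _).
  apply: eq_bigr => k _; congr (_ * _).
  rewrite subSS.
  have := slot_mul ltau [::] B d (q2 * 'X^(n - k.+1)) 'X => /= ->.
  by rewrite -mulrA -exprSr subnSK.
Qed.

(** The Leibniz rule, by induction on [g] in Horner form. It makes [cyclic_diff] independent of how
    a product in one variable is cut into letters. *)
Lemma diff_quotientM A f g B : diff_quotient A (f * g) B =
  diff_quotient A f ((d, g) :: B) + diff_quotient (A ++ [:: (d, f)]) g B.
Proof.
elim/poly_ind: g A f B => [|g c IH] A f B.
  rewrite mulr0 -[0 : {poly F}]/(0%:P) !diff_quotientC addr0.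
  have := slot_const (slot_linear_diff_quotientr A f) [::] B d 0 => /= ->.
  by rewrite mul0r.
rewrite mulrDr mulrA -[f * c%:P]mulrC mul_polyC addrC diff_quotientP.
rewrite diff_quotientMX IH.
have := slot_lin (slot_linear_diff_quotientr A f) [::] B d 1 (g * 'X) c%:P.
rewrite scale1r /= => ->; rewrite mul1r.
have := slot_const (slot_linear_diff_quotientr A f) [::] B d c => /= ->.
have := diff_quotientP (A ++ [:: (d, f)]) B 1 (g * 'X) c%:P.
rewrite scale1r => ->; rewrite diff_quotientC mul1r diff_quotientMX -catA/=.
rewrite (slot_mul ltau) mulrA.
have := slot_mul (slot_linear_diff_quotientr A f) [::] B d g 'X => /= ->.
ring.
Qed.

Lemma slot_linear_cyclic_diffl s : slot_linear (fun A => cyclic_diff A s).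
Proof.
elim: s => [|[b f] s IH] /=; first exact: slot_linear0.
apply: slot_linearD; last exact: (slot_linear_catr [:: (b, f)] IH).
case: (b == d); first exact: slot_linear_diff_quotientl.
exact: slot_linear0.
Qed.

Lemma slot_linear_cyclic_diffr A : slot_linear (cyclic_diff A).
Proof.
split=> a s b.
- move=> c f g; elim: a A => [|[b' h] a IH] A /=.
    have := slot_linear_cyclic_diffl s => - [l _ _].
    rewrite l; case: eqP => _; last by ring.
    by rewrite diff_quotientP; ring.
  rewrite IH; case: eqP => _; last by ring.
  by rewrite (slot_lin (slot_linear_diff_quotientr A h)); ring.
- move=> f g; elim: a A => [|[b' h] a IH] A /=.
    rewrite -catA/= (slot_mul (slot_linear_cyclic_diffl s)).
    case: eqP => [->|_]; last by ring.
    by rewrite diff_quotientM; ring.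
  by rewrite IH (slot_mul (slot_linear_diff_quotientr A h)).
- elim: a A => [|[b' h] a IH] A /=.
    rewrite (slot_one (slot_linear_cyclic_diffl s)) cats0.
    by rewrite diff_quotientC; case: eqP; rewrite add0r.
  by rewrite IH (slot_one (slot_linear_diff_quotientr A h)).
Qed.

Variable p : {poly F}.

Definition schwinger_dyson := forall s, tau ((d, p) :: s) = cyclic_diff [::] s.

(** Both sides factor through the free algebra, so the vanishing of their difference can be tested
    on words in ['X] as well as on alternating centered words. *)
Let defect s := tau ((d, p) :: s) - cyclic_diff [::] s.

Let slot_linear_defect : slot_linear defect.
Proof.
apply: slot_linearB; last exact: slot_linear_cyclic_diffr.
exact: (slot_linear_catl [:: (d, p)] ltau).
Qed.

Lemma schwinger_dyson_letters :
  (forall u : seq bool, tau ((d, p) :: [seq (b, 'X) | b <- u]) =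
     cyclic_diff [::] [seq (b, 'X) | b <- u]) -> schwinger_dyson.
Proof.
move=> H s; apply/eqP; rewrite -subr_eq0; apply/eqP.
apply: (slot_linear_letters slot_linear_defect) => u.
by rewrite /defect H subrr.
Qed.

Definition centered s := forall x, x \in s -> tau [:: x] = 0.

Definition free_functional :=
  forall s, s != [::] -> alternating s -> centered s -> tau s = 0.

Hypothesis tau_nil : tau [::] = 1.
Hypothesis free_tau : free_functional.

Let tauC b c : tau [:: (b, c%:P)] = c.
Proof. by rewrite -[RHS]mulr1 -tau_nil (slot_const ltau [::]). Qed.

Lemma centered1 b f : centered [:: (b, f - (tau [:: (b, f)])%:P)].
Proof.
move=> x; rewrite inE => /eqP ->.
have /= := slot_lin ltau [::] [::] b 1 (f - (tau [:: (b, f)])%:P) (tau [:: (b, f)])%:P.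
by rewrite scale1r subrK mul1r tauC => /eqP; rewrite -subr_eq subrr => /eqP.
Qed.

Lemma centered_cat s t : centered s -> centered t -> centered (s ++ t).
Proof. by move=> cs ct x; rewrite mem_cat => /orP[/cs|/ct]. Qed.

(** The centered part of [g] and its constant both leave an alternating centered word, nonempty in
    the second case thanks to [x]. *)
Lemma free_cons b g x s : x.1 != b -> alternating (x :: s) -> centered (x :: s) ->
  tau ((b, g) :: x :: s) = 0.
Proof.
move=> xb alts cs.
have /= := slot_lin ltau [::] (x :: s) b 1 (g - (tau [:: (b, g)])%:P) (tau [:: (b, g)])%:P.
rewrite scale1r subrK mul1r => ->.
rewrite (slot_const ltau [::]) /= (free_tau _ alts cs)// mulr0 addr0.
apply: free_tau => //.
  by move: alts; rewrite /alternating/= eq_sym xb.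
by rewrite -cat1s; apply: centered_cat => //; exact: centered1.
Qed.

Lemma free_rcons b g x s : x.1 != b -> alternating (rcons s x) -> centered (rcons s x) ->
  tau (rcons s x ++ [:: (b, g)]) = 0.
Proof.
move=> xb alts cs.
have := slot_lin ltau (rcons s x) [::] b 1 (g - (tau [:: (b, g)])%:P) (tau [:: (b, g)])%:P.
rewrite scale1r subrK mul1r => ->.
have s0 : rcons s x != [::] by case: (s).
rewrite (slot_const ltau) cats0 (free_tau _ alts cs)// mulr0 addr0.
apply: free_tau; first by case: (s).
  by rewrite cats1 alternating_rcons2 alts.
by apply: centered_cat => //; exact: centered1.
Qed.

(** The left factor of every term is a prefix followed by a polynomial in the variable [d]. By
    alternation the last letter of the prefix has the other index, so [free_rcons] applies. *)
Lemma free_cyclic_diff A s : A != [::] -> alternating (A ++ s) ->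
  centered (A ++ s) -> cyclic_diff A s = 0.
Proof.
elim: s A => [//|[b f] s IH] A A0 altA cA /=.
rewrite IH ?addr0; [| |by rewrite -catA|by rewrite -catA]; last first.
  by case: (A).
case: eqP => // bd; rewrite /diff_quotient big1// => i _.
rewrite [X in _ * X]big1 ?mulr0// => k _.
case/lastP: A A0 altA cA => // A x _ altA cA.
rewrite free_rcons ?mul0r//.
- move: altA; rewrite -cat_rcons => /alternating_catl.
  by rewrite alternating_rcons2 -bd => /andP[].
- exact: alternating_catl altA.
- by move=> y yA; apply: cA; rewrite mem_cat yA.
Qed.

(* All the terms vanish on an alternating centered word of length at least two,
   so that freeness reduces the relation to a single variable. *)
Lemma free_schwinger_dyson :
  (forall n, tau [:: (d, p * 'X^n)] = diff_quotient [::] 'X^n [::]) ->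
  schwinger_dyson.
Proof.
move=> onevar s; apply/eqP; rewrite -subr_eq0; apply/eqP.
apply: (slot_linear_alternating (e := fun b f => tau [:: (b, f)]) slot_linear_defect).
move=> {}s alts cs; rewrite /defect.
have {}cs : centered s.
  move=> x xs; have [f xE] := cs _ xs.
  by apply: (@centered1 x.1 f); rewrite inE -xE.
(* At [n = 0] the one-variable relation has an empty sum; this settles the empty word. *)
have p0 : tau [:: (d, p)] = 0.
  by have := onevar 0; rewrite diff_quotientXn big_ord0 mulr1.
case: s alts cs => [|[b f] s] alts cs /=; first by rewrite p0 subrr.
have [bd|bd] := eqVneq b d; last first.
  rewrite add0r free_cons// free_cyclic_diff ?subrr//.
(* Only the first letter contributes. If it is the whole word, the one-variable relation applies by
   linearity in [f]; otherwise both sides vanish. *)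
rewrite (free_cyclic_diff (A := [:: (b, f)]))// addr0 bd.
have /= -> := slot_mul ltau [::] s d p f.
apply/eqP; rewrite subr_eq0; apply/eqP.
case: s alts cs => [|x s] alts cs.
  move: f {alts cs}; apply: poly_linear_ext => [c f g|c f g|n].
  - by have := tau_poly_linear [::] d p 1 [::] c f g; rewrite !mulr1.
  - by rewrite diff_quotientP.
  - exact: onevar.
have xd : x.1 != d by move: alts; rewrite /alternating/= bd eq_sym => /andP[].
have altx : alternating (x :: s) by move: alts; rewrite -cat1s => /alternating_catr.
have cx : centered (x :: s) by move=> y ys; apply: cs; rewrite inE ys orbT.
rewrite free_cons// /diff_quotient big1// => i _.
rewrite [X in _ * X]big1 ?mulr0// => k _.
by rewrite [X in _ * X]free_cons ?mulr0.
Qed.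

End DifferenceQuotient.

(** * From the relations for V and U to those for X and Y *)

Section CompressionWords.
Variable F : comNzRingType.
Local Notation word := (seq (bool * {poly F})).
Implicit Types (s w A B : word) (u : seq bool) (b : bool).
Variables tau tauXY : word -> F.
Hypothesis ltau : slot_linear tau.
Hypothesis trace_tau : forall s w, tau (s ++ w) = tau (w ++ s).
Hypothesis ltauXY : slot_linear tauXY.

(** Both X and Y have the form V^(1/2) u V^(1/2), with u = U for [true] and u = 1 - U for
    [false]. *)
Definition compression b : {poly F} := if b then 'X else 1 - 'X.

Definition compression_word u : word :=
  flatten [seq [:: (false, compression b); (true, 'X)] | b <- u].

Hypothesis tauXYE : forall u, tauXY [seq (b, 'X) | b <- u] = tau (compression_word u).

Variables (alpha lambda : F) (rate : bool -> F).

(** Cuts the word before each block of index [b0]. Up to the factor [alpha] this is the cyclic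
    difference of a word in X and Y, by [cyclic_diff_letters]. *)
Fixpoint compression_split b0 A u := match u with
  | [::] => 0
  | b :: u' => (if b == b0 then tau A * tau (compression_word (b0 :: u')) else 0) +
      compression_split b0 (A ++ compression_word [:: b]) u'
  end.

(** The derivative of [compression b]. *)
Let sgn b : F := if b then 1 else -1.

Lemma diff_quotient_compression q1 q2 A b B :
  diff_quotient tau false q1 q2 A (compression b) B =
  sgn b * (tau (A ++ [:: (false, q1)]) * tau ((false, q2) :: B)).
Proof.
case: b; rewrite /sgn /compression ?mul1r ?diff_quotientX//.
rewrite addrC -scaleN1r diff_quotientP diff_quotientX.
by rewrite -[1 : {poly F}]/(1%:P) diff_quotientC// addr0.
Qed.

(* For each block u V of the word, the term of the V relation splits the word
   after u and the term of the U relation splits it inside u; their combination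
   splits it before the block. *)
Lemma cyclic_diff_compression b0 A u :
  cyclic_diff tau true alpha%:P 'X A (compression_word u ++ [:: (false, compression b0)]) +
  alpha * (sgn b0 * cyclic_diff tau false (1 - compression b0) (compression b0) A
    (compression_word u)) = alpha * compression_split b0 A u.
Proof.
elim: u A => [|b u IH] A /=.
  by rewrite !(mulr0, addr0).
rewrite -/(compression_word u) !add0r -/(compression_word [:: b]).
have -> : A ++ compression_word [:: b] = (A ++ [:: (false, compression b)]) ++ [:: (true, 'X)].
  by rewrite -catA.
rewrite [RHS]mulrDr -IH diff_quotientX diff_quotient_compression.
rewrite (slot_const ltau) cats0.
set G := tau ((false, compression b0) :: (true, 'X) :: compression_word u).
have -> : tau ((true, 'X) :: compression_word u ++ [:: (false, compression b0)]) = G.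
  by rewrite -cat_cons trace_tau.
have T : tau (A ++ [:: (false, 1 - compression b0)]) =
    tau A - tau (A ++ [:: (false, compression b0)]).
  rewrite -scaleN1r addrC (slot_lin ltau) (slot_one ltau) cats0; ring.
have T1 : tau (A ++ [:: (false, compression (~~ b0))]) =
    tau A - tau (A ++ [:: (false, compression b0)]).
  by rewrite -T; congr (tau (A ++ [:: (false, _)])); case: (b0); rewrite // opprB addrC subrK.
have [->|bb0] := eqVneq b b0.
  by rewrite T; case: (b0); rewrite /sgn; ring.
have -> : b = ~~ b0 by case: b bb0; case: (b0).
by rewrite T1 T; case: (b0); rewrite /sgn/=; ring.
Qed.

Lemma cyclic_diff_letters b0 u1 u2 :
  cyclic_diff tauXY b0 alpha%:P 'X [seq (b, 'X) | b <- u1] [seq (b, 'X) | b <- u2] =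
  alpha * compression_split b0 (compression_word u1) u2.
Proof.
elim: u2 u1 => [|b u2 IH] u1 /=; first by rewrite mulr0.
have := IH (rcons u1 b); rewrite map_rcons -cats1 => ->.
have -> : compression_word (rcons u1 b) = compression_word u1 ++ compression_word [:: b].
  by rewrite -cats1 /compression_word map_cat flatten_cat.
rewrite [RHS]mulrDr; congr (_ + _); case: eqP => _; last by rewrite mulr0.
rewrite diff_quotientX (slot_const ltauXY) cats0 tauXYE.
by rewrite (tauXYE (b0 :: u2)) mulrA.
Qed.

Hypothesis sdV : schwinger_dyson tau true alpha%:P 'X ('X - (alpha * lambda)%:P).
Hypothesis sdU : forall b, schwinger_dyson tau false (1 - compression b)
  (compression b) (lambda *: 'X - (rate true)%:P).
Hypothesis rateD : rate true + rate false = lambda.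

(** A word u V W, with u the compression of [b0], is rotated to V W u. The V relation leaves
    [alpha * lambda] times the trace of u W, and the U relation turns [lambda] u into [rate b0] plus
    [sgn b0] times a cyclic difference. For [b0 = false] the rate arises as [lambda - rate true]. *)
Lemma schwinger_dyson_compression b0 :
  schwinger_dyson tauXY b0 alpha%:P 'X ('X - (alpha * rate b0)%:P).
Proof.
apply: (schwinger_dyson_letters ltauXY) => u.
have /= -> := cyclic_diff_letters b0 [::] u; rewrite -cyclic_diff_compression.
rewrite slot_linB_cons// slot_const_cons// tauXYE (tauXYE (b0 :: u)) /=.
set W := compression_word u.
have -> : tau ((false, compression b0) :: (true, 'X) :: W) =
    tau ((true, 'X) :: W ++ [:: (false, compression b0)]).
  by rewrite -[RHS]/(tau (((true, 'X) :: W) ++ _)) trace_tau.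
have := sdV (W ++ [:: (false, compression b0)]); rewrite slot_linB_cons// slot_const_cons// => /eqP.
rewrite subr_eq => /eqP ->.
rewrite -sdU trace_tau /=.
rewrite slot_linB_cons// slot_const_cons//.
have := slot_lin_cons ltau W false lambda 'X 0; rewrite addr0 => ->.
rewrite -polyC0 slot_const_cons// mul0r addr0.
rewrite -rateD; case: (b0); rewrite /sgn/=; first by ring.
by rewrite slot_linB_cons// slot_one_cons//; ring.
Qed.

End CompressionWords.

(** * Freeness and marginal moments from the Schwinger-Dyson relations *)

Section SchwingerDysonFree.
Variable F : comNzRingType.
Local Notation word := (seq (bool * {poly F})).
Implicit Types (s w A B : word) (b : bool).
Variable tau : word -> F.
Hypothesis ltau : slot_linear tau.
Hypothesis trace_tau : forall s w, tau (s ++ w) = tau (w ++ s).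
Variables (alpha : F) (rate : bool -> F).
Hypothesis sd : forall b,
  schwinger_dyson tau b alpha%:P 'X ('X - (alpha * rate b)%:P).

Lemma schwinger_dyson_mulX b s :
  tau ((b, 'X) :: s) = alpha * rate b * tau s +
    cyclic_diff tau b alpha%:P 'X [::] s.
Proof.
by rewrite -sd slot_linB_cons// slot_const_cons// addrC subrK.
Qed.

(** The relation on a power of one variable, in the shape of [free_poisson_moment_rec], so that the
    marginal moments can be compared by strong induction. *)
Lemma schwinger_dyson_moment b n : tau [:: (b, 'X^(n.+1))] =
  alpha * (rate b * tau [:: (b, 'X^n)] +
    \sum_(k < n) tau [:: (b, 'X^k)] * tau [:: (b, 'X^(n - k))]).
Proof.
rewrite exprS -slot_mul_cons//.
rewrite schwinger_dyson_mulX mulrDr mulrA; congr (_ + _).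
rewrite /= eqxx addr0 diff_quotientXn mulr_sumr; apply: eq_bigr => k _.
rewrite -exprS subnSK// [_ * alpha%:P]mulrC mul_polyC mulrA; congr (_ * _).
have := slot_lin_cons ltau [::] b alpha 'X^k 0; rewrite addr0 => ->.
by rewrite -polyC0 slot_const_cons// mul0r addr0.
Qed.

Let monomial_vanish b s : (forall n, tau ((b, 'X^n) :: s) = 0) ->
  forall f, tau ((b, f) :: s) = 0.
Proof.
move=> H; apply: poly_linear_ext => [c f g|c f g|//].
  exact: slot_lin_cons.
by rewrite mulr0 addr0.
Qed.

(** Induction on the length of the centered tail, then on the degree of the first letter, which is
    left uncentered. In degree zero, the first letter of [w] is expanded in monomials and becomes
    the uncentered one. In higher degree, the relation is applied to one factor ['X], and every
    resulting term contains a word that is shorter or of smaller degree. *)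
Let schwinger_dyson_vanish n w b m : (size w <= n)%N -> w != [::] ->
  alternating ((b, 'X^m) :: w) -> centered tau w -> tau ((b, 'X^m) :: w) = 0.
Proof.
elim: n w b m => [|n IHn] w b m; first by case: w.
move=> wn w0; have altE k : alternating ((b, 'X^k) :: w) = alternating ((b, 'X^m) :: w).
  by [].
elim/ltn_ind: m altE => -[|m] IHm altE altw cw.
  rewrite expr0 slot_one_cons//.
  case: w wn w0 altE altw cw {IHm} => // -[b' f] w wn _ _ altw cw.
  case: w wn altw cw => [|x w] wn altw cw; first by apply: cw; rewrite inE.
  apply: monomial_vanish => k; apply: IHn => //.
    by move: altw; rewrite -cat1s => /alternating_catr.
  by move=> y yw; apply: cw; rewrite inE yw orbT.
rewrite exprS -slot_mul_cons// schwinger_dyson_mulX.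
rewrite IHm ?altE// mulr0 add0r/= eqxx.
rewrite diff_quotientXn big1 ?add0r => [|k _]; last first.
  rewrite -exprS subnSK// [X in _ * X]IHm ?mulr0 ?altE//.
  by rewrite ltnS leq_subr.
(* [A] is the part of [w] in front of the letter being differentiated. *)
suff H s A : w = A ++ s ->
  cyclic_diff tau b alpha%:P 'X ((b, 'X^m) :: A) s = 0 by exact: (H w [::]).
elim: s A => [//|[c f] s IHs] A wE /=.
rewrite IHs ?addr0 -?catA//; case: eqP => // cb; rewrite /diff_quotient.
have A0 : A != [::].
  apply/eqP => A0; move: altw; rewrite wE A0 cb /alternating/=.
  by rewrite eqxx.
have altA : alternating ((b, 'X^m) :: A).
  by move: altw; rewrite wE -cat_cons => /alternating_catl.
have cA : centered tau A by move=> x xA; apply: cw; rewrite wE mem_cat xA.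
have alts : alternating ((b, f) :: s).
  by move: altw; rewrite wE -cat_cons cb => /alternating_catr.
have cs : centered tau s.
  by move=> x xs; apply: cw; rewrite wE mem_cat inE xs !orbT.
have sn : (size s <= n)%N.
  by move: wn; rewrite wE size_cat/= addnS ltnS; apply: leq_trans; rewrite leq_addl.
have An : s = [::] -> (size A <= n)%N.
  by move=> s0; move: wn; rewrite wE s0 size_cat addn1.
rewrite big1// => i _; rewrite big1 ?mulr0// => k _.
(* If the last letter is cut, the right factor has no tail. The left factor is then rotated, so that
   its two outer letters of index [b] merge in front of [A], which is shorter than [w]. Otherwise
   the right factor has the shorter tail [s]. *)
have [s0|s0] := eqVneq s [::].
  rewrite trace_tau/= slot_mul_cons// [X in X * _]monomial_vanish ?mul0r//.
  by move=> l; apply: IHn => //; exact: An.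
by rewrite [X in _ * X]monomial_vanish ?mulr0// => l; exact: IHn.
Qed.

Lemma schwinger_dyson_free : free_functional tau.
Proof.
case=> // -[b f] w _ altw cw.
case: w altw cw => [|x w] altw cw; first by apply: cw; rewrite inE.
apply: monomial_vanish => m; apply: (@schwinger_dyson_vanish (size (x :: w))) => //.
by move=> y yw; apply: cw; rewrite inE yw orbT.
Qed.

End SchwingerDysonFree.

(** * States on polynomials in bounded operators *)

Section Operators.
Variables (R : realType) (H : hilbertSpace R).
Implicit Types (S T U : 'B(H)) (A : set 'B(H)).

(** Polarization: the sesquilinear defect [B] vanishes on the diagonal because [inner H (S x) x] is
    real, so [B x y] and [B y x] are opposite; replacing [y] by ['i *: y] shows that they are also
    equal. *)
Lemma positive_op_self_adjoint S : positive_op S -> self_adjoint S.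
Proof.
move=> posS.
pose B x y := inner H (S x) y - inner H x (S y).
have innD (x y z : H) : inner H x (y + z) = inner H x y + inner H x z.
  by rewrite linearDr.
have innDl (x y z : H) : inner H (x + y) z = inner H x z + inner H y z.
  by rewrite linearDl.
have BD x y z : B x (y + z) = B x y + B x z.
  by rewrite /B innD linearD innD; ring.
have BDl x y z : B (x + y) z = B x z + B y z.
  by rewrite /B linearD !innDl; ring.
have BZl a x y : B (a *: x) y = a * B x y.
  by rewrite /B [S _]linearZ/= !linearZl_LR /= mulrBr.
have BZr a x y : B x (a *: y) = a^*%R * B x y.
  by rewrite /B [S (a *: _)]linearZ/= !linearZr_LR /= mulrBr.
have Bxx x : B x x = 0.
  apply/eqP; rewrite subr_eq0 [X in _ == X]hermC expr0 mul1r.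
  exact/eqP/esym/conj_Creal/ger0_real/posS.
have Bsym x y : B x y + B y x = 0.
  by have := Bxx (x + y); rewrite BD !BDl !Bxx addr0 add0r addrC.
move=> x y; apply/eqP; rewrite -subr_eq0 -/(B x y); apply/eqP.
have /eqP := Bsym x ('i *: y); rewrite BZl BZr conjCi mulNr addrC subr_eq0.
move=> /eqP/(mulfI (neq0Ci _)) Byx.
have /eqP := Bsym x y; rewrite Byx -mulr2n -mulr_natr mulf_eq0 pnatr_eq0 orbF.
by move/eqP.
Qed.

End Operators.


(** * Polynomial calculus in the algebra and the induced word functional *)

Section StateOnPolynomials.
Variables (R : realType) (W : wstarProbSpace R).
Local Notation H := (whilbert W).
Local Notation C := R[i].
Implicit Types (S T : 'B(H)) (A : set 'B(H)).

Lemma unital_subalgebra_commutant A : unital_subalgebra (commutant A).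
Proof.
split=> [S _|a S T cS cT P AP|S T cS cT P AP]; first by rewrite mulr1 mul1r.
  by rewrite mulrDr mulrDl -op_scalerAr -op_scalerAl (cS _ AP) (cT _ AP).
by rewrite mulrA (cS _ AP) -!mulrA (cT _ AP).
Qed.

(** The algebra equals its bicommutant, and every commutant is a unital subalgebra. *)
Lemma unital_subalgebra_walg : unital_subalgebra (walg W).
Proof.
by have [_ <-] := walg_von_neumann W; exact: unital_subalgebra_commutant.
Qed.

Lemma walgM S T : walg W S -> walg W T -> walg W (S * T).
Proof. by have [_ _] := unital_subalgebra_walg; exact. Qed.

Lemma walgP a S T : walg W S -> walg W T -> walg W (a *: S + T).
Proof. by have [_ + _] := unital_subalgebra_walg; exact. Qed.

Definition peval T (f : {poly C}) : 'B(H) := poly_extension (fun n => T ^+ n) f.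

Lemma pevalP T a f g : peval T (a *: f + g) = a *: peval T f + peval T g.
Proof. exact: poly_extensionP. Qed.

Lemma pevalXn T n : peval T 'X^n = T ^+ n.
Proof. exact: poly_extensionXn. Qed.

Lemma peval1 T : peval T 1 = 1.
Proof. by rewrite -(expr0 'X) pevalXn expr0. Qed.

Lemma pevalX T : peval T 'X = T.
Proof. by rewrite -['X]/('X^1) pevalXn expr1. Qed.

Lemma pevalM T f g : peval T (f * g) = peval T f * peval T g.
Proof.
move: f; apply: poly_linear_extV => [a f h|a f h|n].
- by rewrite mulrDl -scalerAl pevalP.
- by rewrite pevalP mulrDl op_scalerAl.
move: g; apply: poly_linear_extV => [a f h|a f h|m].
- by rewrite mulrDr -scalerAr pevalP.
- by rewrite pevalP mulrDr op_scalerAr.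
by rewrite -exprD !pevalXn exprD.
Qed.

Lemma peval_sub A T f : unital_subalgebra A -> A T -> A (peval T f).
Proof.
move=> [A1 Ap Am] AT.
have A0 : A 0 by have := Ap (-1) _ _ A1 A1; rewrite scaleN1r addNr.
rewrite /peval /poly_extension; elim/big_ind: _ => [//|x y Ax Ay|i _].
  by rewrite -[x]scale1r; exact: Ap.
rewrite -[X in A X]addr0; apply: Ap => //.
elim: (nat_of_ord i) => [|n IH]; first by rewrite expr0.
by rewrite exprS; exact: Am.
Qed.

Lemma generated_subalgebra_poly T S :
  generated_subalgebra T S <-> exists f, S = peval T f.
Proof.
split=> [|[f ->] A [uA AT]]; last by apply: peval_sub => //; exact: AT.
apply: (@smallest_sub _ _ _ [set S' | exists f, S' = peval T f]) => [|_ ->]; last first.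
  by exists 'X; rewrite pevalX.
split=> [|a _ _ [f ->] [g ->]|_ _ [f ->] [g ->]].
- by exists 1; rewrite peval1.
- by exists (a *: f + g); rewrite pevalP.
- by exists (f * g); rewrite pevalM.
Qed.

Variable Z : bool -> 'B(H).
Hypothesis walgZ : forall b, walg W (Z b).

Definition word_eval (s : seq (bool * {poly C})) : 'B(H) :=
  \prod_(x <- s) peval (Z x.1) x.2.

Definition word_state s := wstate W (word_eval s).

Lemma word_eval_cat s t : word_eval (s ++ t) = word_eval s * word_eval t.
Proof. by rewrite /word_eval big_cat. Qed.

Lemma word_eval_cons x s : word_eval (x :: s) = peval (Z x.1) x.2 * word_eval s.
Proof. by rewrite /word_eval big_cons. Qed.

Lemma walg_word_eval s : walg W (word_eval s).
Proof.
elim: s => [|x s IH]; first by rewrite /word_eval big_nil; case: unital_subalgebra_walg.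
rewrite word_eval_cons; apply: walgM => //; apply: peval_sub => //.
exact: unital_subalgebra_walg.
Qed.

Lemma word_state_nil : word_state [::] = 1.
Proof. by rewrite /word_state /word_eval big_nil; case: (wstate_state W). Qed.

Lemma word_state_trace s t : word_state (s ++ t) = word_state (t ++ s).
Proof.
by rewrite /word_state !word_eval_cat; apply: wstate_tracial; exact: walg_word_eval.
Qed.

Lemma slot_linear_word_state : slot_linear word_state.
Proof.
have [lin _ _] := wstate_state W.
split=> a s b; rewrite /word_state.
- move=> c f g; rewrite -lin; do ?exact: walg_word_eval.
  congr wstate; rewrite !word_eval_cat !word_eval_cons/= pevalP.
  by rewrite mulrDl mulrDr -op_scalerAl -op_scalerAr.
- by move=> f g; rewrite !word_eval_cat !word_eval_cons/= pevalM -mulrA.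
- by rewrite !word_eval_cat word_eval_cons/= peval1 mul1r.
Qed.

(** The subalgebra generated by one variable consists of its polynomials, so a word of operators
    lifts letter by letter to a word of polynomials with the same states. *)
Lemma freely_independentE :
  freely_independent (Z true) (Z false) <-> free_functional word_state.
Proof.
have stE (x : bool * {poly C}) : word_state [:: x] = wstate W (peval (Z x.1) x.2).
  by rewrite /word_state /word_eval big_seq1.
split=> fr s.
  move=> s0 alts cs.
  have := fr [seq (x.1, peval (Z x.1) x.2) | x <- s].
  rewrite big_map size_map; apply.
  - by case: (s) s0.
  - by move: alts; rewrite /alternating /unzip1 !sorted_map.
  - move=> _ /mapP[x xs ->] /=; split; last by rewrite -stE cs.
    by case: x.1; apply/generated_subalgebra_poly; exists x.2.
move=> s0 alts cs.
have [w [sE altw cw]] : exists w : seq (bool * {poly C}),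
    [/\ s = [seq (x.1, peval (Z x.1) x.2) | x <- w], unzip1 w = unzip1 s &
    centered word_state w].
  elim: s {s0 alts} cs => [|[b T] s IH] cs; first by exists [::].
  have [|w [sE wE cw]] := IH; first by move=> p ps; apply: cs; rewrite inE ps orbT.
  have /= [bT T0] := cs (b, T) (mem_head _ _).
  have [f fE] : exists f, T = peval (Z b) f.
    by apply/generated_subalgebra_poly; case: (b) bT.
  exists ((b, f) :: w); split=> /=; [by rewrite fE sE|by rewrite wE|].
  move=> x; rewrite inE => /predU1P[->|/cw//].
  by rewrite stE/= -fE.
have := fr w; rewrite /word_state /word_eval sE big_map; apply => //.
  by case: (w) sE s0 => [->|].
by rewrite /alternating altw /unzip1 sorted_map.
Qed.

End StateOnPolynomials.

(** * The semicircle law *)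

Section Chebyshev.
Variables (F : comNzRingType) (c v : F).
Implicit Types (p q : {poly F}).

(* Rescaled Chebyshev polynomials of the second kind, monic and orthogonal for
   the semicircle law of mean c and variance v. *)
Fixpoint chebyshev n : {poly F} := match n with
  | 0%N => 1
  | n'.+1 => match n' with
    | 0%N => 'X - c%:P
    | n''.+1 => chebyshev n' * ('X - c%:P) - v *: chebyshev n''
    end
  end.

Lemma chebyshevSS n :
  chebyshev n.+2 = chebyshev n.+1 * ('X - c%:P) - v *: chebyshev n.
Proof. by []. Qed.

Variable L : {poly F} -> F.
Hypothesis linL : forall a p q, L (a *: p + q) = a * L p + L q.
Hypothesis L_chebyshev : forall n, L (chebyshev n) = (n == 0)%:R.

Let LZ a p : L (a *: p) = a * L p.
Proof.
have L0 : L 0 = 0 by have := linL (-1) 0 0; rewrite scaler0 addr0 mulN1r addNr.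
by rewrite -[a *: p]addr0 linL L0 addr0.
Qed.

Let LD p q : L (p + q) = L p + L q.
Proof. by rewrite -[p]scale1r linL scale1r mul1r. Qed.

(* The free difference quotient of p with L applied to its left leg. *)
Let T : {poly F} -> {poly F} :=
  poly_extension (fun n => \sum_(k < n) L 'X^k *: 'X^(n - k.+1)).

Let TZD a p q : T (a *: p + q) = a *: T p + T q.
Proof. exact: poly_extensionP. Qed.

Let TMX p : T (p * 'X) = T p * 'X + (L p)%:P.
Proof.
move: p; apply: poly_linear_extV => [a p q|a p q|n].
- by rewrite mulrDl -scalerAl TZD.
- rewrite TZD linL mulrDl -scalerAl polyCD polyCM scalerDr -[_ *: (L p)%:P]mul_polyC.
  by rewrite addrACA.
rewrite -exprSr /T !poly_extensionXn big_ord_recr/= subnn expr0 alg_polyC.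
congr (_ + _); rewrite mulr_suml; apply: eq_bigr => k _.
by rewrite -scalerAl -exprSr subSS subnSK.
Qed.

Let T1 : T 1 = 0.
Proof. by rewrite -(expr0 'X) /T poly_extensionXn big_ord0. Qed.

Let TMXc p a : T (p * ('X - a%:P)) = T p * ('X - a%:P) + (L p)%:P.
Proof.
have mulXc q : q * ('X - a%:P) = - a *: q + q * 'X.
  by rewrite mulrBr [q * a%:P]mulrC mul_polyC scaleNr addrC.
by rewrite !mulXc TZD TMX addrA.
Qed.

(** [T] lowers the index: it respects the three-term recurrence up to the constant [L p], which is
    zero on every polynomial of the family but the first. *)
Let T_chebyshev n : T (chebyshev n.+1) = chebyshev n.
Proof.
suff [] : T (chebyshev n.+1) = chebyshev n /\ T (chebyshev n.+2) = chebyshev n.+1 by [].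
have TU1 : T (chebyshev 1) = chebyshev 0.
  rewrite -[chebyshev 1]/('X - c%:P) -[X in T X]mul1r TMXc T1 mul0r add0r.
  by have /= -> := L_chebyshev 0.
elim: n => [|n [IH1 IH2]]; split=> //.
  rewrite chebyshevSS addrC -scaleNr TZD TMXc TU1 mul1r T1 scaler0 add0r.
  by rewrite L_chebyshev addr0.
rewrite chebyshevSS addrC -scaleNr TZD TMXc IH1 IH2 L_chebyshev addr0.
by rewrite chebyshevSS addrC scaleNr.
Qed.

Let defect p := L (p * 'X) - (c * L p + v * L (T p)).

Let defect_lin a p q : defect (a *: p + q) = a * defect p + defect q.
Proof. by rewrite /defect mulrDl -scalerAl TZD !linL; ring. Qed.

Let chebyshevX n : chebyshev n * 'X =
  chebyshev n.+1 + c *: chebyshev n + (if n is n'.+1 then v *: chebyshev n' else 0).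
Proof.
case: n => [|n]; rewrite -mul_polyC; first by rewrite /=; ring.
by rewrite chebyshevSS; ring.
Qed.

Let defect_chebyshev n : defect (chebyshev n) = 0.
Proof.
rewrite /defect chebyshevX !LD LZ L_chebyshev/= add0r.
case: n => [|n].
  have -> : L 0 = 0 by rewrite -(scale0r 0) LZ mul0r.
  by rewrite T1 -(scale0r 0) LZ; ring.
by rewrite T_chebyshev LZ; ring.
Qed.

(** The recursion says that [defect] vanishes at ['X^n]. It vanishes on the family [chebyshev m],
    and the three-term recurrence carries this over to the products with ['X^k]; the case [m = 0]
    gives the claim. *)
Lemma semicircle_moment_rec n : L 'X^(n.+1) =
  c * L 'X^n + v * \sum_(k < n) L 'X^k * L 'X^(n - k.+1).
Proof.
have D0 : defect 0 = 0.
  by have := defect_lin (-1) 0 0; rewrite scaler0 addr0 mulN1r addNr.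
have DZ a p : defect (a *: p) = a * defect p.
  by rewrite -[a *: p]addr0 defect_lin D0 addr0.
have DD p q : defect (p + q) = defect p + defect q.
  by rewrite -[p]scale1r defect_lin scale1r mul1r.
have Z k m : defect (chebyshev m * 'X^k) = 0.
  elim: k m => [|k IH] m; first by rewrite expr0 mulr1 defect_chebyshev.
  rewrite exprS mulrA chebyshevX !mulrDl !DD -scalerAl DZ !IH mulr0 !add0r.
  by case: m => [|m]; rewrite ?mul0r// -scalerAl DZ IH mulr0.
have := Z n 0; rewrite mul1r /defect -exprSr => /eqP; rewrite subr_eq0 => /eqP ->.
congr (_ + _ * _); rewrite /T poly_extensionXn.
elim/big_ind2: _ => [|x x' y y' <- <-|k _]; last by rewrite LZ.
  by rewrite -(scale0r 0) LZ mul0r.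
by rewrite LD.
Qed.

End Chebyshev.

(** * Semicircle integrals by the substitution x = c + r cos t *)

Section TrigonometricSubstitution.
Variable R : realType.
Local Notation mu := (@lebesgue_measure R).
Implicit Types (c r : R) (f F G : R -> R).

Lemma integral_derivative F f (a b : R) : a < b -> continuous f ->
  (forall x : R, is_derive x (1 : R) F (f x)) ->
  (\int[mu]_(x in `[a, b]) (f x)%:E = (F b - F a)%:E)%E.
Proof.
move=> ab cf dF; rewrite (continuous_FTC2 (F := F) ab).
- by rewrite EFinB.
- exact: continuous_subspaceT.
- have cF x : {for x, continuous F}.
    exact/differentiable_continuous/derivable1_diffP.
  split=> [x _||]; [by []|exact/cvg_at_right_filter/cF|exact/cvg_at_left_filter/cF].
- by move=> x _; rewrite derive1E derive_val.
Qed.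

Definition semicircle c r x := Num.sqrt (r ^+ 2 - (x - c) ^+ 2).

Lemma continuous_semicircle c r : continuous (semicircle c r).
Proof.
move=> x; apply: continuous_comp; last exact: sqrt_continuous.
apply: cvgB; first exact: cvg_cst.
by rewrite expr2; apply: cvgM; (apply: cvgB; [exact: cvg_id|exact: cvg_cst]).
Qed.

Lemma semicircle_ge0 c r x : 0 <= semicircle c r x.
Proof. exact: sqrtr_ge0. Qed.

Lemma semicircle_cos c r x : 0 < r -> 0 <= x <= pi ->
  semicircle c r (c + r * cos x) = r * sin x.
Proof.
move=> r0 xpi; rewrite /semicircle [c + _]addrC addrK exprMn.
rewrite -[X in X - _]mulr1 -mulrBr -sin2cos2 -exprMn sqrtr_sqr ger0_norm//.
by rewrite mulr_ge0 ?(ltW r0) ?sin_ge0_pi.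
Qed.

(** One factor [r * sin t] is the semicircle at c + r cos t, the other is the Jacobian. *)
Lemma integral_semicircle_cos c r G : 0 < r ->
  {within `[c - r, c + r], continuous G} ->
  (\int[mu]_(x in `[(c - r)%R, (c + r)%R]) (G x * semicircle c r x)%:E =
   \int[mu]_(t in `[0%R, pi]) (G (c + r * cos t) * (r * sin t) ^+ 2)%:E)%E.
Proof.
move=> r0 cG; pose F t := c + r * cos t.
have dF t : is_derive (t : R) (1 : R) F (- (r * sin t)).
  have -> : F = cst c + r *: (cos : R -> R) by [].
  by apply: is_derive_eq; rewrite add0r [LHS]mulrN.
have F'E : derive1 F = (fun t => - (r * sin t)).
  by apply/funext => t; rewrite derive1E derive_val.
have F0 : F 0 = c + r by rewrite /F cos0 mulr1.
have Fpi : F pi = c - r by rewrite /F cospi mulrN1.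
have cF : continuous F.
  by move=> t; apply/differentiable_continuous/derivable1_diffP.
have cF' : continuous (derive1 F).
  rewrite F'E => t; apply: cvgN; apply: cvgM; first exact: cvg_cst.
  exact: continuous_sin.
rewrite -F0 -Fpi integration_by_substitution_decreasing.
- apply: eq_integral => t; rewrite inE/= in_itv/= => tpi.
  by rewrite F'E/= [(_ * - _)%R]/GRing.mul/= /F semicircle_cos// opprK -mulrA -expr2.
- exact: pi_ge0.
- by move=> x y xpi ypi xy; rewrite /F ltrD2l ltr_pM2l// ltr_cos.
- by move=> x _; exact: cF'.
- by apply/cvg_ex; exists (derive1 F 0); exact/cvg_at_right_filter/cF'.
- by apply/cvg_ex; exists (derive1 F pi); exact/cvg_at_left_filter/cF'.
- split=> [t _||]; [by []|exact/cvg_at_right_filter/cF|exact/cvg_at_left_filter/cF].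
- rewrite F0 Fpi => x; apply: continuousM; first exact: cG.
  exact/continuous_subspaceT/continuous_semicircle.
Qed.

Lemma is_derive_sinZ k x : is_derive (x : R) (1 : R) (fun t => sin (k * t)) (k * cos (k * x)).
Proof.
have -> : (fun t => sin (k * t)) = (sin \o (k *: (@id R))) :> (R -> R) by [].
by apply: is_derive_eq; rewrite /= [k%:A]mulr1 mulrC.
Qed.

Lemma continuous_sinZ k : continuous (fun t : R => sin (k * t)).
Proof.
move=> x; apply: continuous_comp; last exact: continuous_sin.
by apply: cvgM; [exact: cvg_cst|exact: cvg_id].
Qed.

Lemma sin_natMpi n : sin (n%:R * pi) = 0 :> R.
Proof.
elim: n => [|n IH]; first by rewrite mul0r sin0.
by rewrite -natr1 mulrDl mul1r sinD IH sinpi mulr0 mul0r addr0.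
Qed.

Variables (c v : R).
Hypothesis v0 : 0 < v.
Let r := 2 * Num.sqrt v.
Let r0 : 0 < r. Proof. by rewrite mulr_gt0// sqrtr_gt0. Qed.

(** The identity U_n(cos t) sin t = sin((n+1) t), rescaled, proved for two consecutive indices at
    once. *)
Lemma chebyshev_cos n t : (chebyshev c v n).[c + r * cos t] * sin t =
  Num.sqrt v ^+ n * sin (n.+1%:R * t).
Proof.
suff [] : (chebyshev c v n).[c + r * cos t] * sin t =
    Num.sqrt v ^+ n * sin (n.+1%:R * t) /\
  (chebyshev c v n.+1).[c + r * cos t] * sin t =
    Num.sqrt v ^+ n.+1 * sin (n.+2%:R * t) by [].
have sinS (k : nat) : sin (k.+2%:R * t) =
    2 * cos t * sin (k.+1%:R * t) - sin (k%:R * t).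
  have -> : k.+2%:R * t = k.+1%:R * t + t by rewrite -[k.+2%:R]natr1; ring.
  have -> : k%:R * t = k.+1%:R * t - t by rewrite -[k.+1%:R]natr1; ring.
  by rewrite sinD sinB; ring.
elim: n => [|n [IH1 IH2]]; split=> //.
- by rewrite /= hornerC expr0 !mul1r.
- rewrite /= hornerXsubC sinS mul1r mul0r sin0 /r; ring.
rewrite chebyshevSS !hornerE mulrBl -mulrA [_ * sin t]mulrC mulrA IH2.
rewrite -[v * _ * _]mulrA IH1 [in RHS]sinS !exprS /r.
set q := Num.sqrt v; have -> : v = q ^+ 2 by rewrite sqr_sqrtr// ltW.
ring.
Qed.

Let L p := \int[mu]_(x in `[c - r, c + r]) (p.[x] * semicircle c r x).

Let integrable_semicircle p :
  mu.-integrable `[c - r, c + r] (EFin \o (fun x => p.[x] * semicircle c r x)).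
Proof.
apply: continuous_compact_integrable; first exact: segment_compact.
apply: continuous_subspaceT => x; apply: cvgM; first exact: continuous_horner.
exact: continuous_semicircle.
Qed.

Let L_linear a p q : L (a *: p + q) = a * L p + L q.
Proof.
rewrite /L -RintegralZl// -RintegralD//.
  by apply: eq_Rintegral => x _; rewrite hornerD hornerZ mulrDl mulrA.
have := integrable_semicircle (a *: p); apply: eq_integrable => // x _ /=.
by rewrite hornerZ mulrA.
Qed.

Let integral_sinS n : (\int[mu]_(t in `[0%R, pi])
  (sin (n.+1%:R * t) * sin t)%:E = ((n == 0)%:R * (pi / 2))%:E)%E.
Proof.
have cf : continuous (fun t : R => sin (n.+1%:R * t) * sin t).
  by move=> x; apply: cvgM; [exact: continuous_sinZ|exact: continuous_sin].
case: n cf => [|n] cf.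
  pose F : R -> R := 2^-1 *: (@id R) - 4^-1 *: (fun t : R => sin (2 * t)).
  have dF (x : R) : is_derive x (1 : R) F (sin (1%:R * x) * sin x).
    apply: is_derive_eq (is_deriveB _ (is_deriveZ _ (is_derive_sinZ 2 x))) _.
    rewrite mul1r; have -> : 2 * x = x + x by ring.
    rewrite cosD /GRing.scale/= -!expr2 cos2sin2; by field.
  rewrite (integral_derivative (pi_gt0 R) cf dF) /F !fctE (sin_natMpi 2).
  by rewrite mulr0 sin0; congr EFin; rewrite !scaler0 !subr0 mul1r [LHS]mulrC.
(* The integrand is half the difference of the cosines of frequencies [a] and [b]. In the case
   treated before, the lower frequency is zero and its primitive is linear. *)
pose a : R := n.+1%:R; pose b : R := n.+3%:R.
have a0 : a != 0 by rewrite pnatr_eq0.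
have b0 : b != 0 by rewrite pnatr_eq0.
pose F : R -> R := (2 * a)^-1 *: (fun t : R => sin (a * t)) -
  (2 * b)^-1 *: (fun t : R => sin (b * t)).
have dF (x : R) : is_derive x (1 : R) F (sin (n.+2%:R * x) * sin x).
  apply: is_derive_eq (is_deriveB (is_deriveZ _ (is_derive_sinZ a x))
    (is_deriveZ _ (is_derive_sinZ b x))) _.
  have -> : a * x = n.+2%:R * x - x by rewrite /a -[n.+2%:R]natr1; ring.
  have -> : b * x = n.+2%:R * x + x by rewrite /b -[n.+3%:R]natr1; ring.
  by rewrite cosB cosD /GRing.scale/= !invfM -!mulrA !mulKf//; field.
rewrite (integral_derivative (pi_gt0 R) cf dF) /F !fctE !sin_natMpi.
by rewrite !mulr0 sin0 !scaler0 !subr0 mul0r.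
Qed.

Lemma integral_chebyshev n :
  L (chebyshev c v n) = (n == 0)%:R * (2 * pi * v).
Proof.
rewrite /L /Rintegral integral_semicircle_cos//; last first.
  exact/continuous_subspaceT/continuous_horner.
have cf : continuous (fun t : R => sin (n.+1%:R * t) * sin t).
  by move=> x; apply: cvgM; [exact: continuous_sinZ|exact: continuous_sin].
rewrite (_ : integral _ _ _ = (\int[mu]_(t in `[0%R, pi])
  ((r ^+ 2 * Num.sqrt v ^+ n)%:E * (sin (n.+1%:R * t) * sin t)%:E))%E); last first.
  apply: eq_integral => t _; rewrite -EFinM; congr EFin.
  transitivity (r ^+ 2 * ((chebyshev c v n).[c + r * cos t] * sin t) * sin t).
    by ring.
  by rewrite chebyshev_cos; ring.
rewrite integralZl//; last first.
  apply: (@continuous_compact_integrable _ (fun t => sin (n.+1%:R * t) * sin t)).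
    exact: segment_compact.
  exact: continuous_subspaceT.
rewrite integral_sinS -EFinM/=; case: n {cf} => [|n]; last by rewrite !mul0r mulr0.
rewrite expr0 /r exprMn sqr_sqrtr ?(ltW v0)//; by field.
Qed.

Definition semicircle_moment n := L 'X^n / (2 * pi * v).

Lemma semicircle_momentE n :
  (\int[mu]_(x in `[(c - r)%R, (c + r)%R]) (x ^+ n * semicircle c r x)%:E =
   (2 * pi * v * semicircle_moment n)%:E)%E.
Proof.
have k0 : 2 * pi * v != 0 by rewrite !mulf_neq0// ?gt_eqF// pi_gt0.
rewrite /semicircle_moment [_ * (L _ / _)]mulrC divfK// /L fineK; last first.
  exact: (integrable_fin_num _ (integrable_semicircle _)).
by apply: eq_integral => x _; rewrite hornerXn.
Qed.

Lemma semicircle_moment0 : semicircle_moment 0 = 1.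
Proof.
have k0 : 2 * pi * v != 0 by rewrite !mulf_neq0// ?gt_eqF// pi_gt0.
by rewrite /semicircle_moment expr0 (integral_chebyshev 0) mul1r divff.
Qed.

Lemma semicircle_momentS n : semicircle_moment n.+1 = c * semicircle_moment n +
  v * \sum_(k < n) semicircle_moment k * semicircle_moment (n - k.+1).
Proof.
have k0 : 2 * pi * v != 0 by rewrite !mulf_neq0// ?gt_eqF// pi_gt0.
apply: (semicircle_moment_rec (L := fun p => L p / (2 * pi * v))) => [a p q|m].
  by rewrite L_linear mulrDl mulrA.
by rewrite integral_chebyshev mulfK.
Qed.

End TrigonometricSubstitution.

(** * The semicircle density divided by x *)

Section PoissonKernel.
Variable R : realType.
Local Notation mu := (@lebesgue_measure R).

(** The denominator is k |1 + q e^(it)|^2. In the primitive [F], [atan (g t)] is the argument of 1 +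
    q e^(it), whose real part is positive because q < 1. The sine and arctangent terms vanish at
    both ends. *)
Lemma integral_poisson_kernel (k q : R) : 0 < k -> 0 < q < 1 ->
  (\int[mu]_(t in `[0%R, pi])
    ((k * (1 + q ^+ 2) + 2 * k * q * cos t)^-1 * (2 * k * q * sin t) ^+ 2)%:E
   = (2 * k * q ^+ 2 * pi)%:E)%E.
Proof.
move=> k0 /andP[q0 q1].
have D0 (t : R) : 0 < 1 + q * cos t.
  rewrite -ltrBlDl sub0r (lt_le_trans (y := - q)) ?ltrN2//.
  by rewrite -mulrN1 ler_pM2l// cos_geN1.
have E0 (t : R) : 0 < 1 + q ^+ 2 + 2 * q * cos t.
  have := cos2Dsin2 t; have := D0 t; have := sqr_ge0 (q * sin t).
  have := mulr_gt0 (D0 t) (D0 t); nra.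
pose g : R -> R := fun t => (q * sin t) * (1 + q * cos t)^-1.
have dg (t : R) : is_derive t (1 : R) g
    ((q * cos t + q ^+ 2) / (1 + q * cos t) ^+ 2).
  have dD : is_derive t (1 : R) (fun t : R => 1 + q * cos t) (- (q * sin t)).
    have -> : (fun t => 1 + q * cos t) = cst 1 + q *: (cos : R -> R) by [].
    by apply: is_derive_eq; rewrite add0r [LHS]mulrN.
  have dN : is_derive t (1 : R) (fun t : R => q * sin t) (q * cos t).
    have -> : (fun t => q * sin t) = q *: (sin : R -> R) by [].
    exact: is_derive_eq.
  have dV := @is_deriveV _ (fun t => 1 + q * cos t) t _ _ (lt0r_neq0 (D0 t)) dD.
  apply: is_derive_eq (is_deriveM dN dV) _.
  have := cos2Dsin2 t; have := lt0r_neq0 (D0 t); rewrite /GRing.scale/=.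
  move: (sin t) (cos t) => s u D1 su.
  have s2 : s ^+ 2 = 1 - u ^+ 2 by rewrite -su; ring.
  have -> : q * s * (- (1 + q * u) ^- 2 * - (q * s)) =
      q ^+ 2 * s ^+ 2 / (1 + q * u) ^+ 2 by field.
  by rewrite s2; field.
pose F : R -> R := (2 * k * q ^+ 2) *: (@id R) - (2 * k * q) *: (sin : R -> R) +
  (2 * k * (1 - q ^+ 2)) *: (atan \o g).
have dF (t : R) : is_derive t (1 : R) F
    ((k * (1 + q ^+ 2) + 2 * k * q * cos t)^-1 * (2 * k * q * sin t) ^+ 2).
  have dA := is_derive1_comp (is_derive1_atan (g t)) (dg t).
  apply: is_derive_eq (is_deriveD (is_deriveB (is_deriveZ _ (is_derive_id t 1))
    (is_deriveZ _ (is_derive_sin t))) (is_deriveZ _ dA)) _.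
  rewrite /g /GRing.scale/=.
  have := cos2Dsin2 t; have := lt0r_neq0 (D0 t); have := lt0r_neq0 (E0 t).
  move: (sin t) (cos t) => s u E1 D1 su.
  have s2 : s ^+ 2 = 1 - u ^+ 2 by rewrite -su; ring.
  have -> : (1 + (q * s * (1 + q * u)^-1) ^+ 2)^-1 =
      (1 + q * u) ^+ 2 / (1 + q ^+ 2 + 2 * q * u).
    have E2 : 1 + (q * s / (1 + q * u)) ^+ 2 =
        (1 + q ^+ 2 + 2 * q * u) / (1 + q * u) ^+ 2.
      by rewrite exprMn exprVn exprMn s2; field.
    by rewrite E2 invf_div.
  rewrite !exprMn s2; field.
  apply/and3P; split=> //.
  have -> : k * (1 + q ^+ 2) + 2 * k * q * u = k * (1 + q ^+ 2 + 2 * q * u) by ring.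
  by rewrite mulf_neq0// gt_eqF.
have cF : continuous (fun t : R =>
    (k * (1 + q ^+ 2) + 2 * k * q * cos t)^-1 * (2 * k * q * sin t) ^+ 2).
  move=> t; apply: cvgM.
    apply: cvgV.
      by rewrite gt_eqF//; have := E0 t; nra.
    apply: cvgD; first exact: cvg_cst.
    by apply: cvgM; [exact: cvg_cst|exact: continuous_cos].
  by rewrite expr2; apply: cvgM; (apply: cvgM; [exact: cvg_cst|exact: continuous_sin]).
rewrite (integral_derivative (pi_gt0 R) cF dF) /F !fctE /= /g sinpi sin0.
by congr EFin; rewrite !(mulr0, mul0r, atan0, scaler0, subr0, addr0).
Qed.

Lemma integral_semicircle_div_shift (c r z : R) : 0 < r < c + z ->
  (\int[mu]_(x in `[(c - r)%R, (c + r)%R]) ((x + z)^-1 * semicircle c r x)%:E =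
   (pi * (c + z - Num.sqrt ((c + z) ^+ 2 - r ^+ 2)))%:E)%E.
Proof.
move=> /andP[r0 rc]; set C := c + z; set S := Num.sqrt _.
have S2 : S ^+ 2 = C ^+ 2 - r ^+ 2.
  by rewrite sqr_sqrtr// subr_ge0 ler_sqr ?nnegrE ?(ltW r0) ?(ltW rc)// (le_trans (ltW r0)) ?ltW.
have S0 : 0 <= S := sqrtr_ge0 _.
have C0 : 0 < C by exact: lt_trans rc.
have CS0 : 0 < C + S by rewrite ltr_wpDr.
rewrite integral_semicircle_cos//; last first.
  apply: continuous_in_subspaceT => x; rewrite inE/= in_itv/= => /andP[xl _].
  apply: cvgV.
    rewrite gt_eqF// (lt_le_trans _ (lerD xl (lexx z)))//.
    by rewrite -addrA [- r + z]addrC addrA subr_gt0.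
  by apply: cvgD; [exact: cvg_id|exact: cvg_cst].
(* Chosen so that C + r cos t = k (1 + q^2) + 2 k q cos t. *)
pose k := (C + S) / 2; pose q := r / (C + S).
have k0 : 0 < k by rewrite divr_gt0.
have q01 : 0 < q < 1.
  by rewrite divr_gt0//= ltr_pdivrMr// mul1r (lt_le_trans rc)// lerDl.
have nz : C + S != 0 by rewrite gt_eqF.
have Er : r = 2 * k * q by rewrite /k /q; field.
have EC : C = k * (1 + q ^+ 2).
  have r2 : r ^+ 2 = C ^+ 2 - S ^+ 2 by rewrite S2; ring.
  by rewrite /k /q expr_div_n r2; field.
have ES : C - S = 2 * k * q ^+ 2.
  have r2 : r ^+ 2 = C ^+ 2 - S ^+ 2 by rewrite S2; ring.
  by rewrite /k /q expr_div_n r2; field.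
rewrite ES [pi * _]mulrC -(integral_poisson_kernel k0 q01).
apply: eq_integral => t _; congr (_^-1 * _)%:E; last by rewrite -Er.
by rewrite -Er -EC /C addrAC.
Qed.

(** When [r = c], which for the two laws means rate one and [s = 1], the singularity touches the
    support. This case is the limit of the shifts by 1/(n+1), by monotone convergence. *)
Lemma integral_semicircle_div (c r : R) : 0 < r <= c ->
  (\int[mu]_(x in `[(c - r)%R, (c + r)%R]) (x^-1 * semicircle c r x)%:E =
   (pi * (c - Num.sqrt (c ^+ 2 - r ^+ 2)))%:E)%E.
Proof.
move=> /andP[r0]; rewrite le_eqVlt => /predU1P[rc|rc]; last first.
  have := @integral_semicircle_div_shift c r 0; rewrite addr0 r0 rc => <-//.
  by apply: eq_integral => x _; rewrite addr0.
subst c; rewrite !subrr sqrtr0 subr0.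
pose z n : R := n.+1%:R^-1.
have z0 n : 0 < z n by rewrite invr_gt0 ltr0n.
have z_cvg : z @ \oo --> (0 : R) by exact: cvg_harmonic.
pose g n (x : R) := ((x + z n)^-1 * semicircle r r x)%:E.
have gE n : (\int[mu]_(x in `[0%R, (r + r)%R]) g n x =
    (pi * (r + z n - Num.sqrt ((r + z n) ^+ 2 - r ^+ 2)))%:E)%E.
  rewrite -integral_semicircle_div_shift ?subrr// r0/=.
  by rewrite ltrDl.
have lim1 : (\int[mu]_(x in `[0%R, (r + r)%R]) g n x)%E @[n --> \oo] -->
    (pi * r)%:E.
  under eq_fun do rewrite gE.
  apply: cvg_EFin; first by apply: nearW.
  apply: cvgM; first exact: cvg_cst.
  have rz : (r + z n) @[n --> \oo] --> r.
    by rewrite -[X in _ --> X]addr0; apply: cvgD => //; exact: cvg_cst.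
  rewrite -[X in _ --> X]subr0; apply: cvgB => //.
  have <- : Num.sqrt (r ^+ 2 - r ^+ 2) = 0 :> R by rewrite subrr sqrtr0.
  apply: (cvg_comp (fun n => (r + z n) ^+ 2 - r ^+ 2) (@Num.sqrt R)); last exact: sqrt_continuous.
  apply: cvgB; last exact: cvg_cst.
  by rewrite !expr2; under eq_fun do rewrite expr2; exact: cvgM.
have lim2 : (\int[mu]_(x in `[0%R, (r + r)%R]) g n x)%E @[n --> \oo] -->
    (\int[mu]_(x in `[0%R, (r + r)%R]) (x^-1 * semicircle r r x)%:E)%E.
  have -> : (\int[mu]_(x in `[0%R, (r + r)%R]) (x^-1 * semicircle r r x)%:E =
      \int[mu]_(x in `[0%R, (r + r)%R]) limn (g^~ x))%E.
    apply: eq_integral => x; rewrite inE/= in_itv/= => /andP[x0 _].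
    apply/esym/cvg_lim => //; apply: cvg_EFin; first by apply: nearW.
    (* At the edge the semicircle factor is zero, so the inverse of 0 is harmless. *)
    have [->|x_neq0] := eqVneq x 0.
      rewrite /semicircle sub0r sqrrN subrr sqrtr0 mulr0.
      rewrite (_ : fine \o _ = cst 0); first exact: cvg_cst.
      by apply/funext => n /=; rewrite /semicircle sub0r sqrrN subrr sqrtr0 mulr0.
    apply: cvgM; last exact: cvg_cst.
    apply: cvgV => //; rewrite -[X in _ --> X]addr0.
    by apply: cvgD => //; exact: cvg_cst.
  apply: cvg_monotone_convergence => //.
  - move=> n; apply/measurable_EFinP; apply: measurable_funM.
      apply: (measurableT_comp (@measurable_inv R)).
      by apply: measurable_funD.
    apply: measurable_funTS; apply: continuous_measurable_fun.
    exact: continuous_semicircle.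
  - move=> n x; rewrite /= in_itv/= => /andP[x0 _].
    by rewrite lee_fin mulr_ge0 ?semicircle_ge0// invr_ge0 addr_ge0// ltW.
  - move=> x; rewrite /= in_itv/= => /andP[x0 _] m n mn.
    rewrite lee_fin ler_wpM2r ?semicircle_ge0// lef_pV2 ?posrE ?ltr_wpDl//.
    by rewrite lerD2l lef_pV2 ?posrE ?ltr0n// ler_nat.
exact: (cvg_unique _ lim2 lim1).
Qed.

End PoissonKernel.

(** * Moments of the free-Poisson and free-binomial laws *)

Section DensityIntegral.
Variables (R : realType) (f : R -> R).
Hypothesis mf : measurable_fun [set: measurableTypeR R] f.
Hypothesis f0 : forall x, 0 <= f x.
Local Notation mu := (@lebesgue_measure R).
Local Notation nu := (density_measure mf).

Import HBNNSimple.

(** Monotone convergence along simple functions on both sides. On an indicator the identity is the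
    definition of [density_measure], as [f] equals its positive part. *)
Lemma ge0_integral_density (g : measurableTypeR R -> \bar R) :
  (forall x, 0 <= g x)%E -> measurable_fun setT g ->
  (\int[nu]_x g x = \int[mu]_x (g x * (f x)%:E))%E.
Proof.
move=> g0 mg; pose h := nnsfun_approx measurableT mg.
have mEf : measurable_fun [set: measurableTypeR R] (EFin \o f) by exact/measurable_EFinP.
have gE x : g x = lim ((EFin \o h n) x @[n --> \oo]).
  by apply/esym/cvg_lim => //; exact: cvg_nnsfun_approx.
have -> : (\int[nu]_x g x = lim (\int[nu]_x (EFin \o h n) x @[n --> \oo]))%E.
  under eq_integral => x _ do rewrite gE.
  apply: monotone_convergence => //.
  - by move=> n; apply/measurable_EFinP; exact/measurable_funP.
  - by move=> n x _ /=; rewrite lee_fin.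
  - by move=> x _ a b ab; rewrite lee_fin; exact/lefP/nd_nnsfun_approx.
have -> : (\int[mu]_x (g x * (f x)%:E) =
    lim (\int[mu]_x ((EFin \o h n) x * (f x)%:E) @[n --> \oo]))%E.
  have gfE x : (g x * (f x)%:E = lim (((EFin \o h n) x * (f x)%:E) @[n --> \oo]))%E.
    apply/esym/cvg_lim => //; apply: cvgeZr => //.
    exact: cvg_nnsfun_approx.
  under eq_integral => x _ do rewrite gfE.
  apply: monotone_convergence => //.
  - move=> n; apply: emeasurable_funM => //.
    by apply/measurable_EFinP; exact/measurable_funP.
  - by move=> n x _ /=; rewrite mule_ge0 ?lee_fin.
  - move=> x _ a b ab /=; rewrite lee_wpmul2r ?lee_fin//.
    exact/lefP/nd_nnsfun_approx.
congr (lim (_ @ \oo)); apply/funext => n.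
have indich r : measurable_fun [set: measurableTypeR R]
    (fun x => (r * \1_(h n @^-1` [set r]) x)%:E).
  by apply: (measurable_comp measurableT) => //; exact: measurable_funM.
transitivity (\int[nu]_x (\sum_(y \in range (h n))
    (y * \1_(h n @^-1` [set y]) x)%:E))%E.
  by apply: eq_integral => t _; rewrite /= fimfunE -fsumEFin.
rewrite ge0_integral_fsum//; last by move=> m y _; exact: nnfun_muleindic_ge0.
transitivity (\int[mu]_x (\sum_(y \in range (h n))
    (y * \1_(h n @^-1` [set y]) x)%:E * (f x)%:E))%E; last first.
  apply: eq_integral => x _.
  rewrite -ge0_mule_fsuml => [|y]; last exact: nnfun_muleindic_ge0.
  by rewrite fsumEFin // -(fimfunE _ x).
rewrite ge0_integral_fsum//; last 2 first.
- by move=> y; apply: emeasurable_funM.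
- move=> m y _; apply: mule_ge0; first exact: nnfun_muleindic_ge0.
  by rewrite lee_fin.
apply: eq_fsbigr => r rhn.
under eq_integral do rewrite EFinM.
rewrite integralZl_indic_nnsfun//.
under [RHS]eq_integral do rewrite EFinM -muleA.
rewrite ge0_integralZl//.
- congr (_ * _)%E.
  rewrite integral_indic// setIT /density_measure.
  under [RHS]eq_integral do rewrite muleC.
  rewrite [RHS](eq_integral ((EFin \o f) \_ (h n @^-1` [set r]))); last first.
    by move=> x _; rewrite epatch_indic.
  rewrite -integral_mkcond; apply: eq_integral => x _ /=.
  by rewrite (@ge0_funrposE _ _ setT)// ?inE.
- by apply: emeasurable_funM => //; exact/measurable_EFinP.
- by move=> t _; rewrite mule_ge0 ?lee_fin.
- by move: rhn; rewrite inE => -[t _ <-]; rewrite lee_fin.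
Qed.

End DensityIntegral.

Section FreeDistributionIntegrals.
Variable R : realType.
Local Notation mu := (@lebesgue_measure R).
Implicit Types (l a s t x : R) (g : measurableTypeR R -> R).

Let integral_atom (k : {nonneg R}) x g : (forall x, 0 <= g x) ->
  measurable_fun setT g ->
  (\int[mscale k \d_(x : measurableTypeR R)]_y (g y)%:E = (k%:num * g x)%:E)%E.
Proof.
move=> g0 mg; have mEg : measurable_fun setT (fun x => (g x)%:E) by exact/measurable_EFinP.
rewrite ge0_integral_mscale//; last by move=> y _; rewrite lee_fin.
by rewrite integral_dirac// diracT mul1e -EFinM.
Qed.

Lemma ge0_integral_free_poisson l a g : 0 < a -> (forall x, 0 <= g x) ->
  measurable_fun setT g ->
  (\int[free_poisson l a]_x (g x)%:E = (Num.max 0 (1 - l) * g 0)%:E +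
    \int[mu]_x (g x * free_poisson_pdf l a x)%:E)%E.
Proof.
move=> a0 g0 mg; have mEg : measurable_fun setT (fun x => (g x)%:E) by exact/measurable_EFinP.
rewrite ge0_integral_measure_add//; last by move=> y _; rewrite lee_fin.
rewrite integral_atom//; congr (_ + _)%E; rewrite ge0_integral_density//.
by move=> x; exact: free_poisson_pdf_ge0.
Qed.

Lemma ge0_integral_free_binomial s t g : 0 < s -> 0 < t -> 1 < s + t ->
  (forall x, 0 <= g x) -> measurable_fun setT g ->
  (\int[free_binomial s t]_x (g x)%:E = (Num.max 0 (1 - s) * g 0)%:E +
    \int[mu]_x (g x * free_binomial_pdf s t x)%:E + (Num.max 0 (1 - t) * g 1)%:E)%E.
Proof.
move=> s0 t0 st1 g0 mg.
have mEg : measurable_fun setT (fun x => (g x)%:E) by exact/measurable_EFinP.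
have g0' x : (0 <= (g x)%:E)%E by rewrite lee_fin.
rewrite ge0_integral_measure_add// ge0_integral_measure_add//.
rewrite !integral_atom//; congr (_ + _ + _)%E; rewrite ge0_integral_density//.
by move=> x; exact: free_binomial_pdf_ge0.
Qed.

End FreeDistributionIntegrals.

(** * From integrals of absolute values to signed integrals *)

Section NonnegativeAlmostEverywhere.
Variables (R : realType) (m : {measure set (measurableTypeR R) -> \bar R}).
Variables (h : measurableTypeR R -> R) (M : R).
Hypothesis mh : measurable_fun setT h.
Hypothesis h_ge0 : m [set x | h x < 0] = 0%E.
Hypothesis hM : (\int[m]_x `|h x|%:E)%E = M%:E.

Lemma ae_ge0_integrable : m.-integrable setT (EFin \o h).
Proof.
apply/integrableP; split; first exact/measurable_EFinP.
by rewrite (_ : integral _ _ _ = M%:E) ?ltry// -hM; apply: eq_integral.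
Qed.

Lemma ae_ge0_Rintegral : \int[m]_x h x = M.
Proof.
rewrite /Rintegral -[RHS]/(fine M%:E) -hM; congr fine.
apply: ae_eq_integral => //; first exact/measurable_EFinP.
  by apply/measurable_EFinP; exact: measurableT_comp.
exists [set x | h x < 0]; split=> //.
  rewrite (_ : [set x | _] = setT `&` h @^-1` `]-oo, 0[%classic); first exact: mh.
  by apply/seteqP; split=> x /=; rewrite in_itv/=; tauto.
move=> x /= /not_implyP[_ hx]; rewrite ltNge; apply/negP => h0; apply: hx.
by rewrite ger0_norm.
Qed.

End NonnegativeAlmostEverywhere.

Section FreeDistributionMoments.
Variable R : realType.
Local Notation mu := (@lebesgue_measure R).
Implicit Types (l a s t x : R).

Let integral_support (lo hi : R) (k : R -> R) : lo < hi ->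
  measurable_fun `]lo, hi[ k ->
  (\int[mu]_x (if x \in `]lo, hi[ then k x else 0)%:E =
   \int[mu]_(x in `[lo, hi]) (k x)%:E)%E.
Proof.
move=> lohi mk; rewrite [RHS]integral_itv_bndoo; last exact/measurable_EFinP.
rewrite [RHS]integral_mkcond; apply: eq_integral => x _.
by rewrite patchE mem_setE; case: ifP.
Qed.

Lemma free_poisson_null l a (A : set (measurableTypeR R)) : 0 < a ->
  (forall x, A x -> x < 0) -> free_poisson l a A = 0%E.
Proof.
move=> a0 Aneg; rewrite free_poissonE diracE memNset ?mule0 ?add0e; last first.
  by move=> /Aneg; rewrite ltxx.
apply: integral0_eq => x /Aneg x0; rewrite /funrpos/= /free_poisson_pdf.
rewrite ifF ?maxxx//; apply/negbTE; rewrite in_itv/= negb_and -leNgt.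
by rewrite (le_trans (ltW x0))// mulr_ge0 ?sqr_ge0// ltW.
Qed.

Lemma free_binomial_null s t (A : set (measurableTypeR R)) :
  0 < s -> 0 < t -> 1 < s + t -> (forall x, A x -> x < 0 \/ 1 < x) ->
  free_binomial s t A = 0%E.
Proof.
move=> s0 t0 st1 Aout; rewrite free_binomialE !diracE !memNset; last 2 first.
- by move=> /Aout; rewrite ltxx ltr10 => -[].
- by move=> /Aout; rewrite ltxx ltr10 => -[].
rewrite !mule0 adde0 add0e.
apply: integral0_eq => x /Aout x01; rewrite /funrpos/= /free_binomial_pdf.
rewrite ifF ?maxxx//; apply/negbTE; rewrite in_itv/= negb_and -!leNgt.
case: x01 => [x0|x1]; apply/orP; [left|right].
  by rewrite (le_trans (ltW x0))// sqr_ge0.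
exact: le_trans (free_binomial_upper_le1 s0 t0 st1) (ltW x1).
Qed.

(** * Moments of the free-Poisson law *)

Section FreePoisson.
Variables (l a : R).
Hypotheses (l0 : 0 < l) (a0 : 0 < a).
Let c := a * (1 + l).
Let v := l * a ^+ 2.
Let r := 2 * Num.sqrt v.
Let v0 : 0 < v. Proof. by rewrite mulr_gt0// exprn_gt0. Qed.
Let r0 : 0 < r. Proof. by rewrite mulr_gt0// sqrtr_gt0. Qed.
Let rE : r = 2 * (a * Num.sqrt l).
Proof.
rewrite /r /v sqrtrM ?(ltW l0)// sqrtr_sqr ger0_norm ?(ltW a0)//.
by rewrite [Num.sqrt l * a]mulrC.
Qed.
Let sl2 : Num.sqrt l ^+ 2 = l. Proof. by rewrite sqr_sqrtr// ltW. Qed.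

Let loE : a * (1 - Num.sqrt l) ^+ 2 = c - r.
Proof. by rewrite rE /c; move: sl2; move: (Num.sqrt l) => q <-; ring. Qed.

Let hiE : a * (1 + Num.sqrt l) ^+ 2 = c + r.
Proof. by rewrite rE /c; move: sl2; move: (Num.sqrt l) => q <-; ring. Qed.

Let r_le_c : r <= c.
Proof. by rewrite -subr_ge0 -loE mulr_ge0 ?sqr_ge0// ltW. Qed.

Let pdfE x : free_poisson_pdf l a x =
  if x \in `]c - r, c + r[ then (2 * pi * a)^-1 * (x^-1 * semicircle c r x) else 0.
Proof.
rewrite /free_poisson_pdf loE hiE; case: ifP => // _.
rewrite div1r [(_ * x)^-1]invfM -[LHS]mulrA /semicircle; congr (_ * (_ * Num.sqrt (_ - _))).
by rewrite rE !exprMn sl2; ring.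
Qed.

(** [k] extends g(x)/x from the positive half-line, which contains the open support. *)
Let integral_pdf (g k : R -> R) : measurable_fun setT k ->
  (forall x, 0 <= x -> 0 <= k x) -> (forall x, 0 < x -> g x * x^-1 = k x) ->
  (\int[mu]_x (g x * free_poisson_pdf l a x)%:E = (2 * pi * a)^-1%:E *
   \int[mu]_(x in `[(c - r)%R, (c + r)%R]) (k x * semicircle c r x)%:E)%E.
Proof.
move=> mk k0 gk.
have mkw : measurable_fun setT (fun x => k x * semicircle c r x).
  by apply: measurable_funM => //; apply: continuous_measurable_fun; exact: continuous_semicircle.
rewrite -ge0_integralZl//; last 3 first.
- exact/measurable_EFinP/measurable_funTS.
- move=> x /=; rewrite in_itv/= => /andP[xl _].
  by rewrite lee_fin mulr_ge0 ?semicircle_ge0// k0// (le_trans _ xl)// subr_ge0.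
- by rewrite lee_fin invr_ge0 !mulr_ge0 ?pi_ge0// ltW.
rewrite -(@integral_support _ _
  (fun x => (2 * pi * a)^-1 * (k x * semicircle c r x))); last 2 first.
- by rewrite ltrD2l gtrN.
- by apply: measurable_funTS; exact: measurable_funM.
apply: eq_integral => x _; congr EFin; rewrite pdfE; case: ifPn; last by rewrite mulr0.
rewrite in_itv/= => /andP[xl _]; rewrite -gk; last first.
  by rewrite (le_lt_trans _ xl)// subr_ge0.
by rewrite mulrCA !mulrA.
Qed.

(** The continuous part has mass (1 + l - |1 - l|)/2 = min(1, l), and the atom supplies the rest. *)
Lemma free_poisson_mass : free_poisson l a setT = 1%E.
Proof.
have pia0 : 2 * pi * a != 0 :> R by rewrite !mulf_neq0 ?gt_eqF ?pi_gt0.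
have -> : free_poisson l a setT = (\int[free_poisson l a]_x (cst 1 x)%:E)%E.
  by have := integral_cst (free_poisson l a) measurableT 1%E; rewrite mul1e => <-.
rewrite ge0_integral_free_poisson// (integral_pdf (k := @GRing.inv R)); last 3 first.
- exact: measurable_inv.
- by move=> x x0; rewrite invr_ge0.
- by move=> x _; rewrite mul1r.
rewrite integral_semicircle_div ?r0//.
have -> : c ^+ 2 - r ^+ 2 = (a * (1 - l)) ^+ 2.
  by rewrite rE /c !exprMn sl2; ring.
rewrite sqrtr_sqr normrM (gtr0_norm a0) -!EFinM -EFinD mulr1 /c; congr EFin.
move: (pi_gt0 R) pia0; move: (@pi R) => p p0 pia0.
by have [l1|l1] := lerP 0 (1 - l); [rewrite (ger0_norm l1)|rewrite (ltr0_norm l1)];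
  field; rewrite !gt_eqF.
Qed.

Lemma free_poisson_abs_moment n :
  (\int[free_poisson l a]_x `|x ^+ (n.+1)|%:E)%E = (l * a * semicircle_moment c v n)%:E.
Proof.
rewrite ge0_integral_free_poisson//; last first.
  by apply: measurableT_comp => //; exact: measurable_funX.
rewrite expr0n/= normr0 mulr0 add0e (integral_pdf (k := fun x => x ^+ n)); last 3 first.
- exact: measurable_funX.
- by move=> x x0; exact: exprn_ge0.
- by move=> x x0; rewrite ger0_norm ?exprn_ge0 ?(ltW x0)// exprSr mulfK ?gt_eqF.
rewrite semicircle_momentE// -EFinM; congr EFin.
rewrite /v; move: (pi_gt0 R); move: (@pi R) => p p0.
by field; rewrite !gt_eqF.
Qed.

Let moment_null n : free_poisson l a [set x | x ^+ n < 0] = 0%E.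
Proof.
apply: free_poisson_null => // x /=; rewrite ltNge; apply: contraNT.
by rewrite -leNgt => x0; exact: exprn_ge0.
Qed.

Let free_poisson_abs_moment_fin n : exists M,
  (\int[free_poisson l a]_x `|x ^+ n|%:E)%E = M%:E.
Proof.
case: n => [|n]; last by eexists; exact: free_poisson_abs_moment.
exists 1; rewrite -free_poisson_mass.
have := integral_cst (free_poisson l a) measurableT 1%E; rewrite mul1e => <-.
by apply: eq_integral => x _; rewrite expr0 normr1.
Qed.

Lemma free_poisson_integrable n :
  (free_poisson l a).-integrable setT (fun t => (t ^+ n)%:E).
Proof.
have [M hM] := free_poisson_abs_moment_fin n.
by apply: (ae_ge0_integrable _ hM); exact: measurable_funX.
Qed.

Lemma free_poisson_moment0 : \int[free_poisson l a]_t t ^+ 0 = 1.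
Proof.
under eq_Rintegral do rewrite expr0.
by rewrite Rintegral_cst// mul1r free_poisson_mass.
Qed.

Lemma free_poisson_momentS n :
  \int[free_poisson l a]_t t ^+ (n.+1) = l * a * semicircle_moment c v n.
Proof.
apply: (ae_ge0_Rintegral _ (moment_null n.+1) (free_poisson_abs_moment n)).
exact: measurable_funX.
Qed.

(** Positive moments are semicircle moments shifted by one. The term [k = 0] joins the linear one to
    give the mean [c], and the other terms give the variance [v]. *)
Lemma free_poisson_moment_rec n : \int[free_poisson l a]_t t ^+ (n.+1) =
  a * (l * \int[free_poisson l a]_t t ^+ n + \sum_(k < n)
    (\int[free_poisson l a]_t t ^+ k) * (\int[free_poisson l a]_t t ^+ (n - k))).
Proof.
case: n => [|n].
  by rewrite big_ord0 addr0 free_poisson_moment0 free_poisson_momentS semicircle_moment0//; ring.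
rewrite big_ord_recl free_poisson_moment0 subn0 mul1r !free_poisson_momentS.
under eq_bigr => k _.
  rewrite lift0 subSS -(subnSK (ltn_ord k)) !free_poisson_momentS mulrACA; over.
rewrite -mulr_sumr semicircle_momentS// /c /v; ring.
Qed.

End FreePoisson.

(** * Moments of the free-binomial law *)

Section FreeBinomial.
Variables s t : R.
Hypotheses (s0 : 0 < s) (t0 : 0 < t) (st1 : 1 < s + t).
Let l := s + t.
Let A := s / l * (1 - 1 / l).
Let B := 1 / l * (1 - s / l).
Let c := A + B.
Let v := A * B.
Let r := 2 * Num.sqrt v.
Let l0 : 0 < l. Proof. exact: addr_gt0. Qed.
Let lN0 : l != 0. Proof. by rewrite gt_eqF. Qed.
Let A0 : 0 < A.
Proof. by rewrite mulr_gt0 ?divr_gt0// subr_gt0 ltr_pdivrMr// mul1r. Qed.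
Let B0 : 0 < B.
Proof. by rewrite mulr_gt0 ?divr_gt0// subr_gt0 ltr_pdivrMr// mul1r ltrDl. Qed.
Let v0 : 0 < v. Proof. exact: mulr_gt0. Qed.
Let r0 : 0 < r. Proof. by rewrite mulr_gt0// sqrtr_gt0. Qed.

Let sqrtAB : exists a b, [/\ a ^+ 2 = A, b ^+ 2 = B, Num.sqrt v = a * b,
  free_binomial_lower s t = (a - b) ^+ 2 & free_binomial_upper s t = (a + b) ^+ 2].
Proof.
exists (Num.sqrt A), (Num.sqrt B).
by rewrite !sqr_sqrtr ?ltW// /v sqrtrM// ltW.
Qed.

Let loE : free_binomial_lower s t = c - r.
Proof. by have [a [b [aA bB sv -> _]]] := sqrtAB; rewrite /c /r sv -aA -bB; ring. Qed.

Let hiE : free_binomial_upper s t = c + r.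
Proof. by have [a [b [aA bB sv _ ->]]] := sqrtAB; rewrite /c /r sv -aA -bB; ring. Qed.

Let r_le_c : r <= c. Proof. by rewrite -subr_ge0 -loE sqr_ge0. Qed.

Let hi_le1 : c + r <= 1. Proof. by rewrite -hiE free_binomial_upper_le1. Qed.

Let pdfE x : free_binomial_pdf s t x = if x \in `]c - r, c + r[ then
  l / (2 * pi) * ((x * (1 - x))^-1 * semicircle c r x) else 0.
Proof.
rewrite /free_binomial_pdf loE hiE; case: ifP => // _.
have -> : (x - (c - r)) * (c + r - x) = r ^+ 2 - (x - c) ^+ 2 by ring.
by rewrite -/(semicircle c r x) -[2 * pi * x * _]mulrA invfM -/l; ring.
Qed.

Let integral_pdf (g k : R -> R) : measurable_fun setT k ->
  (forall x, 0 <= x -> 0 <= k x) ->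
  (forall x, 0 < x < 1 -> g x * (x * (1 - x))^-1 = k x) ->
  (\int[mu]_x (g x * free_binomial_pdf s t x)%:E = (l / (2 * pi))%:E *
   \int[mu]_(x in `[(c - r)%R, (c + r)%R]) (k x * semicircle c r x)%:E)%E.
Proof.
move=> mk k0 gk.
have mkw : measurable_fun setT (fun x => k x * semicircle c r x).
  by apply: measurable_funM => //; apply: continuous_measurable_fun; exact: continuous_semicircle.
rewrite -ge0_integralZl//; last 3 first.
- exact/measurable_EFinP/measurable_funTS.
- move=> x /=; rewrite in_itv/= => /andP[xl _].
  by rewrite lee_fin mulr_ge0 ?semicircle_ge0// k0// (le_trans _ xl)// subr_ge0.
- by rewrite lee_fin divr_ge0// ?mulr_ge0 ?pi_ge0// ltW.
rewrite -(@integral_support _ _ (fun x => l / (2 * pi) * (k x * semicircle c r x))); last 2 first.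
- by rewrite ltrD2l gtrN.
- by apply: measurable_funTS; exact: measurable_funM.
apply: eq_integral => x _; congr EFin; rewrite pdfE; case: ifPn; last by rewrite mulr0.
rewrite in_itv/= => /andP[xl xu]; rewrite -gk; last first.
  by rewrite (le_lt_trans _ xl) ?subr_ge0//= (lt_le_trans xu).
by rewrite mulrCA !mulrA.
Qed.

Let diff_ge0 n x : 0 <= x <= 1 -> 0 <= x ^+ n - x ^+ (n.+1).
Proof.
move=> /andP[x0 x1]; rewrite exprSr -{1}[x ^+ n]mulr1 -mulrBr.
by rewrite mulr_ge0 ?exprn_ge0// subr_ge0.
Qed.

Let diff_null n : free_binomial s t [set x | x ^+ n - x ^+ (n.+1) < 0] = 0%E.
Proof.
apply: free_binomial_null => // x /= d0.
have [x0|x0] := ltP x 0; first by left.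
have [x1|x1] := ltP 1 x; first by right.
by move: d0; rewrite ltNge diff_ge0// x0.
Qed.

Let measurable_diff n : measurable_fun setT (fun x : R => x ^+ n - x ^+ (n.+1)).
Proof. by apply: measurable_funB; exact: measurable_funX. Qed.

(** Here 1 - x cancels and 1/x remains; the sign of 1 - s decides whether the atom at 0 is
    present. *)
Let abs_diff0 : (\int[free_binomial s t]_x `|x ^+ 0 - x ^+ 1|%:E)%E = (t / l)%:E.
Proof.
rewrite ge0_integral_free_binomial//; last first.
  by apply: measurableT_comp => //; exact: (measurable_diff 0).
rewrite (integral_pdf (k := @GRing.inv R)); last 3 first.
- exact: measurable_inv.
- by move=> x x0; rewrite invr_ge0.
- move=> x /andP[x0 x1]; have x1' : 0 < 1 - x by rewrite subr_gt0.
  rewrite expr0 expr1 gtr0_norm// invfM mulrCA mulfV ?mulr1// gt_eqF//.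
rewrite integral_semicircle_div ?r0//.
have -> : c ^+ 2 - r ^+ 2 = (A - B) ^+ 2.
  by rewrite /c /r exprMn sqr_sqrtr ?(ltW v0)// /v; ring.
have AB : A - B = (s - 1) / l by rewrite /A /B; field.
rewrite sqrtr_sqr AB normrM normfV (gtr0_norm l0) !expr0 !expr1 subr0 subrr normr0 normr1.
rewrite mulr0 adde0 mulr1 -!EFinM -EFinD; congr EFin.
rewrite /c /A /B; move: (pi_gt0 R) => /gt_eqF/negbT; move: (@pi R) => p p0.
have -> : t = l - s by rewrite /l addrC addKr.
move: l lN0 => L LN0; have [s1|s1] := lerP 0 (1 - s).
  rewrite ler0_norm; last by rewrite -opprB oppr_le0.
  by field; rewrite LN0.
rewrite gtr0_norm; last by rewrite -opprB oppr_gt0.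
by field; rewrite LN0.
Qed.

(** The factor x (1 - x) cancels the denominator of the density and kills both atoms. *)
Let abs_diffS n : (\int[free_binomial s t]_x `|x ^+ (n.+1) - x ^+ (n.+2)|%:E)%E =
  (l * v * semicircle_moment c v n)%:E.
Proof.
rewrite ge0_integral_free_binomial//; last first.
  by apply: measurableT_comp => //; exact: measurable_diff.
rewrite (integral_pdf (k := fun x => x ^+ n)); last 3 first.
- exact: measurable_funX.
- by move=> x x0; exact: exprn_ge0.
- move=> x /andP[x0 x1]; have x1' : 0 < 1 - x by rewrite subr_gt0.
  rewrite ger0_norm ?diff_ge0 ?ltW//.
  by rewrite !exprS; field; rewrite !gt_eqF.
rewrite semicircle_momentE// !expr0n !expr1n/= !subrr !normr0 !mulr0 add0e adde0.
rewrite -EFinM; congr EFin; move: (pi_gt0 R) => /gt_eqF/negbT; move: (@pi R) => p p0.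
by field.
Qed.

(** The distribution hypothesis on U supplies mass and integrability. The differences computed above
    then determine all moments. *)
Hypothesis mass1 : free_binomial s t setT = 1%E.
Hypothesis integrableX : forall n, (0 < n)%N ->
  (free_binomial s t).-integrable setT (fun x => (x ^+ n)%:E).

Local Notation m n := (\int[free_binomial s t]_x x ^+ n).

Let m0 : m 0 = 1.
Proof.
under eq_Rintegral do rewrite expr0.
by rewrite Rintegral_cst// mul1r mass1.
Qed.

Let integrableXn n : (free_binomial s t).-integrable setT (fun x => (x ^+ n)%:E).
Proof.
case: n => [|n]; last exact: integrableX.
apply/integrableP; split; first by apply/measurable_EFinP; exact: measurable_funX.
have := integral_cst (free_binomial s t) measurableT 1%E; rewrite mul1e mass1 => int1.
rewrite (eq_integral (cst 1%E)) => [|x _ /=]; last by rewrite expr0 normr1.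
by rewrite int1 ltry.
Qed.

Let mB n : m n - m n.+1 = \int[free_binomial s t]_x (x ^+ n - x ^+ (n.+1)).
Proof. by rewrite RintegralB//; exact: integrableXn. Qed.

Let d0 : m 0 - m 1 = t / l.
Proof. by rewrite mB; exact: (ae_ge0_Rintegral (measurable_diff 0) (diff_null 0) abs_diff0). Qed.

Let dS n : m n.+1 - m n.+2 = l * v * semicircle_moment c v n.
Proof.
by rewrite mB; exact: (ae_ge0_Rintegral (measurable_diff n.+1) (diff_null n.+1) (abs_diffS n)).
Qed.

(** Subtracting consecutive relations yields [key], in which all moments but the mean [m 1] occur
    through the differences [m k - m k.+1]. It is the semicircle recursion: the linear terms and the
    term [k = 0] add up to [l * c]. *)
Lemma free_binomial_moment_rec n : l * m n.+1 - s * m n =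
  \sum_(k < n) (m k - m k.+1) * m (n - k).
Proof.
elim: n => [|n IH].
  have -> : m 1 = 1 - t / l by rewrite -d0 m0 subKr.
  rewrite big_ord0 m0 /l; field; exact: lN0.
have key : l * (m n.+1 - m n.+2) - s * (m n - m n.+1) =
    \sum_(k < n) (m k - m k.+1) * (m (n - k) - m (n - k).+1) - (m n - m n.+1) * m 1.
  have m1E : m 1 = s / l.
    have -> : m 1 = 1 - t / l by rewrite -d0 m0 subKr.
    by rewrite -[1](divff lN0) -mulrBl /l addrK.
  rewrite m1E; case: {IH} n => [|n].
    rewrite big_ord0 d0 dS semicircle_moment0// /v /A /B.
    have -> : t = l - s by rewrite /l addrC addKr.
    by move: l lN0 => L LN0; field.
  rewrite big_ord_recl subn0 d0 !dS.
  under eq_bigr => k _.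
    rewrite lift0 subSS -(subnSK (ltn_ord k)) !dS mulrACA; over.
  rewrite -mulr_sumr semicircle_momentS//.
  move: (\sum_(k < n) _) => sum.
  have cE : l * c = s - s / l + t / l.
    have -> : t = l - s by rewrite /l addrC addKr.
    by rewrite /c /A /B; move: l lN0 => L LN0; field.
  transitivity (l * v * (l * c) * semicircle_moment c v n + l * v * (l * v) * sum -
    s * (l * v * semicircle_moment c v n)); first by ring.
  by rewrite cE; ring.
have -> : l * m n.+2 - s * m n.+1 = (l * m n.+1 - s * m n) -
  (l * (m n.+1 - m n.+2) - s * (m n - m n.+1)) by ring.
rewrite IH key opprB addrCA -sumrB big_ord_recr/= subSnn addrC; congr (_ + _).
apply: eq_bigr => k _; rewrite -mulrBr subKr subSn//.
exact/ltnW/ltn_ord.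
Qed.

End FreeBinomial.
End FreeDistributionMoments.

(** * The Lukacs property *)

Section MainProof.
Variables (R : realType) (W : wstarProbSpace R).
Local Notation H := (whilbert W).
Local Notation C := R[i].
Local Notation toC := (real_complex R).

(** Order zero is included: there both sides are 1, by normalization. *)
Lemma has_distribution_moment (T : 'B(H)) (mu : {measure set (measurableTypeR R) -> \bar R}) n :
  has_distribution T mu -> wstate W (T ^+ n) = toC (\int[mu]_t t ^+ n).
Proof.
move=> [_ _ mass mom]; case: n => [|n]; last by have [] := mom n.+1 isT.
have [_ _ ->] := wstate_state W.
under eq_Rintegral do rewrite expr0.
by rewrite Rintegral_cst// mul1r mass.
Qed.

Variables (V U S : 'B(H)).
Hypotheses (WV : walg W V) (WU : walg W U) (WS : walg W S) (SS : S * S = V).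

Let Z b := if b then V else U.
Let ZXY b := if b then S * U * S else V - S * U * S.

Let walg_sub T1 T2 : walg W T1 -> walg W T2 -> walg W (T1 - T2).
Proof. by move=> W1 W2; rewrite -scaleN1r addrC; exact: walgP. Qed.

Let WZ b : walg W (Z b). Proof. by case: b. Qed.

Let WX : walg W (S * U * S). Proof. by do !apply: walgM. Qed.

Lemma walg_compressions b : walg W (ZXY b).
Proof. by case: b => //; exact: walg_sub. Qed.

Let ZXYE b : ZXY b = S * peval U (compression C b) * S.
Proof.
case: b; rewrite /compression ?pevalX//.
rewrite -scaleN1r addrC pevalP pevalX peval1 scaleN1r mulrDr mulrDl mulr1 SS.
by rewrite mulrN mulNr addrC.
Qed.

(* Both square roots of a letter S u S are merged with those of its neighbours,
   cyclically for the outermost two, which is where the trace property enters. *)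
Lemma word_state_compression u :
  word_state ZXY [seq (b, 'X) | b <- u] = word_state Z (compression_word C u).
Proof.
have shift v : word_eval ZXY [seq (b, 'X) | b <- v] * S =
    S * word_eval Z (compression_word C v).
  elim: v => [|b v IH] /=; first by rewrite /word_eval !big_nil mulr1 mul1r.
  rewrite /compression_word/= !word_eval_cons/= !pevalX -mulrA IH ZXYE.
  by rewrite -/(compression_word C v) -SS !mulrA.
case: u => [|b u]; first by rewrite /word_state /word_eval !big_nil.
rewrite /word_state /compression_word /=.
rewrite !word_eval_cons/= !pevalX ZXYE -!mulrA wstate_tracial//; last first.
  do !apply: walgM => //; last by apply: walg_word_eval => c; exact: walg_compressions.
  by apply: peval_sub => //; exact: unital_subalgebra_walg.
by rewrite -!mulrA shift [S * (S * _)]mulrA SS.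
Qed.

End MainProof.

Local Notation toC := (real_complex _).

Theorem theorem3p2 (R : realType) (W : wstarProbSpace R)
    (alpha sigma theta lambda : R) (V U sqrtV : 'B(whilbert W)) :
  0 < alpha -> 0 < sigma -> 0 < theta -> 1 < sigma + theta ->
  lambda = sigma + theta ->
  freely_independent V U ->
  has_distribution V (free_poisson lambda alpha) ->
  has_distribution U (free_binomial sigma theta) ->
  is_sqrt_of sqrtV V ->
  let X := sqrtV * U * sqrtV in
  let Y := V - sqrtV * U * sqrtV in
  [/\ freely_independent X Y,
      has_distribution X (free_poisson sigma alpha) &
      has_distribution Y (free_poisson theta alpha)].
Proof.
move=> alpha0 sigma0 theta0 st1 lambdaE freeVU distV distU [WS posS SS] X Y.
have lambda0 : 0 < lambda by rewrite lambdaE addr_gt0.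
have [WV saV _ _] := distV.
have [WU saU massU _] := distU.
have saS := positive_op_self_adjoint posS.
pose Z b := if b then V else U.
pose ZXY b := if b then X else Y.
pose rate b := if b then sigma else theta.
have WZ b : walg W (Z b) by case: b.
have WXY : forall b, walg W (ZXY b) := walg_compressions WV WU WS.
have ltau := slot_linear_word_state WZ.
have ltauXY := slot_linear_word_state WXY.
have free_tau : free_functional (word_state Z) by apply/freely_independentE.
have momE (b : bool) n : word_state Z [:: (b, 'X^n)] = wstate W (Z b ^+ n).
  by rewrite /word_state /word_eval big_seq1/= pevalXn.
have lin1 (b : bool) (c : R[i]) f g : word_state Z [:: (b, c *: f + g)] =
    c * word_state Z [:: (b, f)] + word_state Z [:: (b, g)].
  exact: slot_lin_cons.
have linZ (b : bool) (c : R[i]) f : word_state Z [:: (b, c *: f)] =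
    c * word_state Z [:: (b, f)].
  have := lin1 b c f 0; rewrite addr0 => ->.
  by rewrite -polyC0 slot_const_cons// mul0r addr0.
have linB (b : bool) f g : word_state Z [:: (b, f - g)] =
    word_state Z [:: (b, f)] - word_state Z [:: (b, g)].
  exact: slot_linB_cons.
(* Freeness leaves only powers of V to check, where the relation is the moment recursion. *)
have sdV : schwinger_dyson (word_state Z) true (toC alpha)%:P 'X
    ('X - (toC alpha * toC lambda)%:P).
  apply: (free_schwinger_dyson ltau (word_state_nil Z) free_tau) => n.
  have mom k := has_distribution_moment k distV.
  rewrite mulrBl -exprS linB mul_polyC linZ !momE/= !mom.
  rewrite free_poisson_moment_rec// diff_quotientXn.
  rewrite -!rmorphM -rmorphB/= mulrDr mulrA [X in toC X]addrAC subrr add0r.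
  rewrite rmorphM rmorph_sum mulr_sumr; apply: eq_bigr => k _.
  rewrite [_ * (toC alpha)%:P]mulrC mul_polyC linZ -exprS subnSK// !momE/= !mom.
  by rewrite rmorphM mulrA.
have sdU b : schwinger_dyson (word_state Z) false (1 - compression _ b)
    (compression _ b) (toC lambda *: 'X - (toC sigma)%:P).
  apply: (free_schwinger_dyson ltau (word_state_nil Z) free_tau) => n.
  have mom k := has_distribution_moment k distU.
  have X1 k : word_state Z [:: (false, 'X^k * (1 - 'X))] =
      toC (\int[free_binomial sigma theta]_x x ^+ k -
           \int[free_binomial sigma theta]_x x ^+ k.+1).
    by rewrite mulrBr mulr1 -exprSr linB !momE/= !mom rmorphB.
  rewrite mulrBl -scalerAl -exprS linB linZ mul_polyC linZ !momE/= !mom.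
  rewrite -!rmorphM -rmorphB/= lambdaE.
  rewrite free_binomial_moment_rec//; last by move=> k k0; have [_ _ _ /(_ k k0)[]] := distU.
  rewrite diff_quotientXn rmorph_sum; case: b => /=.
    apply: eq_bigr => k _; rewrite X1 -exprS subnSK// momE/= mom.
    by rewrite rmorphM.
  (* For [b = false] the factors ['X] and [1 - 'X] trade legs, so the sum is read backwards. *)
  rewrite (reindex_inj rev_ord_inj)/=; apply: eq_bigr => k _.
  rewrite subKr -exprSr [(1 - 'X) * _]mulrC X1 momE/= mom mulrC rmorphM.
  by rewrite subKn// subnSK.
have sd b : schwinger_dyson (word_state ZXY) b (toC alpha)%:P 'X
    ('X - (toC alpha * toC (rate b))%:P).
  apply: (schwinger_dyson_compression ltau _ ltauXY _ sdV sdU (rate := fun b => toC (rate b))).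
  - by move=> s w; exact: word_state_trace.
  - exact: word_state_compression.
  - by rewrite /= -rmorphD lambdaE.
have traceXY s w : word_state ZXY (s ++ w) = word_state ZXY (w ++ s).
  exact: word_state_trace.
have dist b : has_distribution (ZXY b) (free_poisson (rate b) alpha).
  have rate0 : 0 < rate b by case: b.
  split.
  - exact: WXY.
  - have saX : self_adjoint X by move=> x y; rewrite /X !opME saS saU saS.
    case: b {rate0} => //= x y.
    by rewrite linearBr linearBl; congr (_ - _); [exact: saV | exact: saX].
  - exact: free_poisson_mass.
  - move=> r _; split; first exact: free_poisson_integrable.
    have momXY n : word_state ZXY [:: (b, 'X^n)] = wstate W (ZXY b ^+ n).
      by rewrite /word_state /word_eval big_seq1/= pevalXn.
    (* Moments of [ZXY b] and of the law obey the same recursion with the same start. *)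
    rewrite -momXY; elim/ltn_ind: r => -[|n] IH.
      rewrite expr0 slot_one_cons// word_state_nil.
      under eq_Rintegral do rewrite expr0.
      by rewrite Rintegral_cst// mul1r free_poisson_mass.
    rewrite (schwinger_dyson_moment ltauXY sd) free_poisson_moment_rec// IH//.
    rewrite rmorphM rmorphD rmorphM /=; congr (_ * (_ + _)).
    rewrite rmorph_sum; apply: eq_bigr => k _.
    rewrite rmorphM/= !IH// ltnS; [exact: leq_subr|exact: ltnW].
split; [|exact: (dist true)|exact: (dist false)].
have [_ free_XY] := freely_independentE ZXY; apply: free_XY.
exact: (schwinger_dyson_free ltauXY traceXY sd).
Qed.
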